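(* The Nichols algebra $\mathfrak B(V_{2,1})$ is, as an algebra, the algebra generated by the elements $x=e_1$, $y=e_2$ subject to the relations $$x^2=0,\qquad xy+\xi yx=0,\qquad y^4=0.$$ In particular, $\dim\mathfrak B(V_{2,1})=8$.
   Context: $\Bbbk$ is an algebraically closed field of characteristic zero and $\xi\in\Bbbk$ is a fixed primitive $4$-th root of unity. $\mathcal K$ is the $8$-dimensional Hopf algebra over $\Bbbk$ generated as an algebra by $a,b,c,d$ with relations $ab=\xi ba$, $ac=\xi ca$, $cb=bc=0$, $cd=\xi dc$, $bd=\xi db$, $ad=da$, $ad=1$, $b^2=c^2=0$, $a^2c=b$, $a^4=1$, with $\Delta(a)=a\otimes a+b\otimes c$, $\Delta(b)=a\otimes b+b\otimes d$, $\Delta(c)=c\otimes a+d\otimes c$, $\Delta(d)=c\otimes b+d\otimes d$, $\varepsilon(a)=\varepsilon(d)=1$, $\varepsilon(b)=\varepsilon(c)=0$, $\mathcal S(a)=d$, $\mathcal S(b)=\xi b$, $\mathcal S(c)=-\xi c$, $\mathcal S(d)=a$. ${}^{\mathcal K}_{\mathcal K}\mathcal{YD}$ is the category of left Yetter-Drinfeld modules over $\mathcal K$: left modules and left comodules $M$ (coaction $\delta(m)=m_{(-1)}\otimes m_{(0)}$) with $\delta(h\cdot m)=h_{(1)}m_{(-1)}\mathcal S(h_{(3)})\otimes h_{(2)}\cdot m_{(0)}$; its braiding is $c_{M,N}(m\otimes n)=m_{(-1)}\cdot n\otimes m_{(0)}$. The Nichols algebra $\mathfrak B(V)$ is the (unique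 up to isomorphism) $\mathbb N$-graded braided Hopf algebra $R=\bigoplus_{n\ge0}R(n)$ in this category with $R(0)\simeq\Bbbk$, $R(1)\simeq V$, $R(1)$ equal to the space of primitive elements of $R$, and $R$ generated as an algebra by $R(1)$. For $i\in\mathbb Z_4$ and $\lambda=\xi^i$, $V_{i,1}\in{}^{\mathcal K}_{\mathcal K}\mathcal{YD}$ has basis $e_1,e_2$, action $a\cdot e_1=\lambda e_1$, $b\cdot e_1=c\cdot e_1=0$, $d\cdot e_1=\lambda^{-1}e_1$, $a\cdot e_2=-\xi\lambda e_2$, $b\cdot e_2=\lambda^2e_1$, $c\cdot e_2=e_1$, $d\cdot e_2=\xi\lambda^{-1}e_2$, and coaction $\delta(e_1)=d\otimes e_1+(\lambda^3-\xi\lambda)c\otimes e_2$, $\delta(e_2)=a\otimes e_2+\frac12(\lambda+\xi\lambda^3)b\otimes e_1$. Here $i=2$, $\lambda=-1$. *)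

(* Defs.v *)
From HB Require Import structures.
From mathcomp Require Import all_boot all_order all_algebra.
From mathcomp Require Import finmap monalg.
From mathcomp Require Import boolp.

Set Implicit Arguments.
Unset Strict Implicit.
Unset Printing Implicit Defensive.

Import GRing.Theory.
Local Open Scope ring_scope.

Reserved Notation "u \ox v" (at level 40, left associativity).
Reserved Notation "\tsum_ ( x , y <- t ) E"
  (at level 41, x name, y name, t at level 200, E at level 41,
   format "\tsum_ ( x ,  y  <-  t )  E").
Reserved Notation "h \act m" (at level 38, right associativity).

Section LinearSpan.
Context (k : nzRingType) (M : lmodType k).
Implicit Types (P : M -> Prop) (x y : M).

Definition lspan P x : Prop :=
  exists2 s : seq (k * M),
    (forall p, p \in s -> P p.2) & x = \sum_(p <- s) p.1 *: p.2.

Lemma lspan_sub P x : P x -> lspan P x.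
Proof.
move=> Px; exists [:: (1, x)]; last by rewrite big_seq1 scale1r.
by move=> p; rewrite inE => /eqP ->.
Qed.

Lemma lspan0 P : lspan P 0.
Proof. by exists [::]; rewrite ?big_nil. Qed.

Lemma lspanD P x y : lspan P x -> lspan P y -> lspan P (x + y).
Proof.
move=> [s Ps ->] [t Pt ->]; exists (s ++ t); last by rewrite big_cat.
by move=> p; rewrite mem_cat => /orP[/Ps|/Pt].
Qed.

Lemma lspanZ P c x : lspan P x -> lspan P (c *: x).
Proof.
move=> [s Ps ->]; exists [seq (c * p.1, p.2) | p <- s].
  by move=> p /mapP[q /Ps Pq ->].
by rewrite big_map scaler_sumr; apply: eq_bigr => p _; rewrite scalerA.
Qed.

Lemma lspan_ker (W : lmodType k) (f : {linear M -> W}) P x :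
  (forall y, P y -> f y = 0) -> lspan P x -> f x = 0.
Proof.
move=> f0 [s Ps ->]; rewrite linear_sum big_seq big1 // => p /Ps Pp.
by rewrite linearZ_LR /= f0 ?scaler0.
Qed.

End LinearSpan.

(** The tensor product of two vector spaces: the free module on [U * V] modulo
    the subspace spanned by the bilinearity relators. *)
Section TensorProduct.
Context (k : fieldType) (U V : lmodType k).

Local Notation F := {malg k[(U * V)%type]}.
Local Notation g u v := (<< (u, v) >> : F).

Definition tensor_relator (z : F) : Prop :=
  [\/ exists u u' v, z = g (u + u') v - g u v - g u' v,
      exists u v v', z = g u (v + v') - g u v - g u v',
      exists c u v, z = g (c *: u) v - c *: g u v
    | exists c u v, z = g u (c *: v) - c *: g u v].

Definition tensor_null : pred F := fun z => `[< lspan tensor_relator z >].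

Fact tensor_null_zmod_closed : zmod_closed tensor_null.
Proof.
split=> [|x y /asboolP hx /asboolP hy]; apply/asboolP; first exact: lspan0.
by rewrite -scaleN1r; apply: lspanD => //; apply: lspanZ.
Qed.

HB.instance Definition _ :=
  GRing.isZmodClosed.Build F tensor_null tensor_null_zmod_closed.

Local Notation Q := {ideal_quot (GRing.ZmodClosed.clone F tensor_null _)}.

Definition tensor : Type := Q.
HB.instance Definition _ := GRing.Zmodule.on tensor.

Definition tensor_pi (x : F) : tensor := \pi_Q%qT x.
Definition tensor_repr (t : tensor) : F := repr (t : Q).

Lemma tensor_reprK : cancel tensor_repr tensor_pi.
Proof. exact: reprK. Qed.

Lemma tensor_piD x y : tensor_pi (x + y) = tensor_pi x + tensor_pi y.
Proof. exact: (raddfD \pi_Q%qT). Qed.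

Lemma tensor_piP x y :
  tensor_pi x = tensor_pi y <-> lspan tensor_relator (x - y).
Proof.
split=> [/eqP|h]; last apply/eqP.
  by rewrite -Quotient.idealrBE => /asboolP.
by rewrite -Quotient.idealrBE; apply/asboolP.
Qed.

Definition tensor_scale (c : k) (t : tensor) : tensor :=
  tensor_pi (c *: tensor_repr t).

Lemma tensor_piZ c x : tensor_pi (c *: x) = tensor_scale c (tensor_pi x).
Proof.
apply/tensor_piP; rewrite -scalerBr; apply: lspanZ.
by apply/tensor_piP; rewrite tensor_reprK.
Qed.

Fact tensor_scaleA c d t :
  tensor_scale c (tensor_scale d t) = tensor_scale (c * d) t.
Proof. by rewrite -[t]tensor_reprK -!tensor_piZ scalerA. Qed.

Fact tensor_scale1 : left_id 1 tensor_scale.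
Proof. by move=> t; rewrite -[t]tensor_reprK -tensor_piZ scale1r. Qed.

Fact tensor_scaleDr : right_distributive tensor_scale +%R.
Proof.
move=> c t s /=; rewrite -[t]tensor_reprK -[s]tensor_reprK.
by rewrite -tensor_piD -!tensor_piZ -tensor_piD scalerDr.
Qed.

Fact tensor_scaleDl t : {morph tensor_scale^~ t : c d / c + d}.
Proof.
by move=> c d; rewrite -[t]tensor_reprK -!tensor_piZ -tensor_piD scalerDl.
Qed.

HB.instance Definition _ := GRing.Zmodule_isLmodule.Build k tensor
  tensor_scaleA tensor_scale1 tensor_scaleDr tensor_scaleDl.

Definition tens (u : U) (v : V) : tensor := tensor_pi (g u v).

Fact tensor_pi_is_linear : linear tensor_pi.
Proof. by move=> c x y; rewrite tensor_piD tensor_piZ. Qed.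
HB.instance Definition _ :=
  GRing.isLinear.Build k F tensor _ tensor_pi tensor_pi_is_linear.

Lemma tensDl u u' v : tens (u + u') v = tens u v + tens u' v.
Proof.
rewrite -tensor_piD; apply/tensor_piP; apply: lspan_sub; constructor 1.
by exists u, u', v; rewrite opprD addrA.
Qed.

Lemma tensDr u v v' : tens u (v + v') = tens u v + tens u v'.
Proof.
rewrite -tensor_piD; apply/tensor_piP; apply: lspan_sub; constructor 2.
by exists u, v, v'; rewrite opprD addrA.
Qed.

Lemma tensZl c u v : tens (c *: u) v = c *: tens u v.
Proof.
rewrite -[RHS]tensor_piZ; apply/tensor_piP; apply: lspan_sub; constructor 3.
by exists c, u, v.
Qed.

Lemma tensZr c u v : tens u (c *: v) = c *: tens u v.
Proof.
rewrite -[RHS]tensor_piZ; apply/tensor_piP; apply: lspan_sub; constructor 4.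
by exists c, u, v.
Qed.

Definition free_sum (W : lmodType k) (f : U -> V -> W) (z : F) : W :=
  \sum_(p <- msupp z) z@_p *: f p.1 p.2.

(** [tsum t f] is [\sum_i f (u_i) (v_i)] for a chosen expression
    [t = \sum_i u_i \ox v_i]; it does not depend on the choice as soon as [f] is
    bilinear ([tsum_tens], [tsum_is_linear]), the only case in which it is
    meant to be used. *)
Definition tsum (t : tensor) (W : lmodType k) (f : U -> V -> W) : W :=
  free_sum f (tensor_repr t).

Lemma tensor_sum t :
  t = \sum_(p <- msupp (tensor_repr t)) (tensor_repr t)@_p *: tens p.1 p.2.
Proof.
rewrite -{1}[t]tensor_reprK {1}[tensor_repr t]monalgE raddf_sum /=.
apply: eq_bigr => -[u v] _; rewrite -[RHS]tensor_piZ; congr tensor_pi.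
by apply/malgP => w; rewrite mcoeffZ !mcoeffU mulrnAr mulr1.
Qed.

Section Bilinear.
Context (W : lmodType k) (f : U -> V -> W).
Hypotheses (fl : forall v, linear (f^~ v)) (fr : forall u, linear (f u)).

Lemma free_sumEw (d : {fset (U * V)%type}) z : (msupp z `<=` d)%fset ->
  free_sum f z = \sum_(p <- d) z@_p *: f p.1 p.2.
Proof.
move=> le_d; rewrite /free_sum (big_fset_incl _ le_d) //= => p _ hp.
by rewrite mcoeff_outdom ?scale0r.
Qed.

Fact free_sum_is_linear : linear (free_sum f).
Proof.
move=> c x y; pose d := (msupp (c *: x + y) `|` (msupp x `|` msupp y))%fset.
rewrite !(@free_sumEw d) ?fsubsetUl //; first last.
- by rewrite /d fsetUCA fsubsetUl.
- by rewrite /d fsetUA fsubsetUr.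
rewrite scaler_sumr -big_split; apply: eq_bigr => p _ /=.
by rewrite mcoeffD mcoeffZ scalerDl scalerA.
Qed.

Let fsum : {linear F -> W} := HB.pack (free_sum f)
  (GRing.isLinear.Build k F W *:%R (free_sum f) free_sum_is_linear).

Lemma free_sumU u v : free_sum f (g u v) = f u v.
Proof.
rewrite (@free_sumEw [fset (u, v)]%fset) ?msuppU_le //.
by rewrite big_seq_fset1 mcoeffUU scale1r.
Qed.

Lemma tsum_pi z : tsum (tensor_pi z) f = free_sum f z.
Proof.
apply/eqP; rewrite -subr_eq0 /tsum -(raddfB fsum); apply/eqP.
apply: (@lspan_ker _ _ _ _ tensor_relator); last first.
  by apply/tensor_piP; rewrite tensor_reprK.
have fsZ c x : free_sum f (c *: x) = c *: free_sum f x.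
  exact: (linearZ_LR fsum).
have fsB x y : free_sum f (x - y) = free_sum f x - free_sum f y.
  exact: (raddfB fsum).
have fD u u' v : f (u + u') v = f u v + f u' v.
  by have := fl v 1 u u'; rewrite !scale1r.
have fD' u v v' : f u (v + v') = f u v + f u v'.
  by have := fr u 1 v v'; rewrite !scale1r.
have f0 v : f 0 v = 0 by apply: (addrI (f 0 v)); rewrite -fD !addr0.
have f0' u : f u 0 = 0 by apply: (addrI (f u 0)); rewrite -fD' !addr0.
have fZ c u v : f (c *: u) v = c *: f u v.
  by have := fl v c u 0; rewrite !addr0 f0 addr0.
have fZ' c u v : f u (c *: v) = c *: f u v.
  by have := fr u c v 0; rewrite !addr0 f0' addr0.
move=> y /=; case=> [[u[u'[v ->]]]|[u[v[v' ->]]]|[c[u[v ->]]]|[c[u[v ->]]]].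
- by rewrite !fsB !free_sumU fD [f u v + _]addrC addrK subrr.
- by rewrite !fsB !free_sumU fD' [f u v + _]addrC addrK subrr.
- by rewrite fsB fsZ !free_sumU fZ subrr.
- by rewrite fsB fsZ !free_sumU fZ' subrr.
Qed.

Lemma tsum_tens u v : tsum (tens u v) f = f u v.
Proof. by rewrite tsum_pi free_sumU. Qed.

Lemma tsum_is_linear : linear (fun t => tsum t f).
Proof.
move=> c t s /=; rewrite -[t]tensor_reprK -[s]tensor_reprK -(linearP tensor_pi) !tsum_pi.
exact: free_sum_is_linear.
Qed.

End Bilinear.
End TensorProduct.

Notation "U \ox V" := (tensor U V) : type_scope.
Notation "u \ox v" := (tens u v) : ring_scope.
Notation "\tsum_ ( x , y <- t ) E" := (tsum t (fun x y => E)) : ring_scope.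

HB.mixin Record isHopf (k : fieldType) H of GRing.Algebra k H := {
  comul : {linear H -> (H \ox H)%type};
  counit : {scalar H};
  antipode : {linear H -> H};
  comulA : forall h : H,
    \tsum_(x, y <- comul h) \tsum_(y1, y2 <- comul y) (x \ox (y1 \ox y2)) =
    \tsum_(x, y <- comul h) \tsum_(x1, x2 <- comul x) (x1 \ox (x2 \ox y));
  counitKl : forall h : H, \tsum_(x, y <- comul h) (counit x *: y) = h;
  counitKr : forall h : H, \tsum_(x, y <- comul h) (counit y *: x) = h;
  comul1 : comul 1 = 1 \ox 1;
  comulM : forall g h : H,
    comul (g * h) =
    \tsum_(g1, g2 <- comul g) \tsum_(h1, h2 <- comul h)
      ((g1 * h1) \ox (g2 * h2));
  counit1 : counit 1 = 1;
  counitM : forall g h : H, counit (g * h) = counit g * counit h;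
  antipodeKl : forall h : H,
    \tsum_(x, y <- comul h) (antipode x * y) = (counit h)%:A;
  antipodeKr : forall h : H,
    \tsum_(x, y <- comul h) (x * antipode y) = (counit h)%:A
}.

#[short(type="hopfAlgType")]
HB.structure Definition HopfAlgebra (k : fieldType) :=
  {H of GRing.Algebra k H & isHopf k H}.

HB.mixin Record isYetterDrinfeld (k : fieldType) (H : hopfAlgType k) M
    of GRing.Lmodule k M := {
  act : H -> M -> M;
  coact : {linear M -> (H \ox M)%type};
  act_linearl : forall m : M, linear (act^~ m);
  act_linearr : forall h : H, linear (act h);
  act_1 : forall m : M, act 1 m = m;
  act_mul : forall (g h : H) (m : M), act (g * h) m = act g (act h m);
  coactA : forall m : M,
    \tsum_(h, n <- coact m) \tsum_(h1, h2 <- comul h) (h1 \ox (h2 \ox n)) =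
    \tsum_(h, n <- coact m) (h \ox coact n);
  coact_counit : forall m : M, \tsum_(h, n <- coact m) (counit h *: n) = m;
  coact_act : forall (h : H) (m : M),
    coact (act h m) =
    \tsum_(h1, h' <- comul h) \tsum_(h2, h3 <- comul h') \tsum_(g, n <- coact m)
      ((h1 * g * antipode h3) \ox act h2 n)
}.

#[short(type="ydModType")]
HB.structure Definition YetterDrinfeld (k : fieldType) (H : hopfAlgType k) :=
  {M of GRing.Lmodule k M & isYetterDrinfeld k H M}.

Notation "h \act m" := (act h m) : ring_scope.

(** [braiding m n] is the value of the braiding of the category on [m \ox n]. *)
Definition braiding (k : fieldType) (H : hopfAlgType k) (M N : ydModType H)
    (m : M) (n : N) : N \ox M :=
  \tsum_(h, m0 <- coact m) ((h \act n) \ox m0).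

HB.mixin Record isBraidedHopf (k : fieldType) (H : hopfAlgType k) R
    of GRing.Algebra k R & YetterDrinfeld k H R := {
  actr1 : forall h : H, h \act (1 : R) = (counit h)%:A;
  actrM : forall (h : H) (r s : R),
    h \act (r * s) = \tsum_(h1, h2 <- comul h) ((h1 \act r) * (h2 \act s));
  coactr1 : coact (1 : R) = 1 \ox 1;
  coactrM : forall r s : R,
    coact (r * s) =
    \tsum_(g, r0 <- coact r) \tsum_(h, s0 <- coact s) ((g * h) \ox (r0 * s0));
  bcomul : {linear R -> (R \ox R)%type};
  bcounit : {scalar R};
  bantipode : {linear R -> R};
  bcomul_act : forall (h : H) (r : R),
    bcomul (h \act r) =
    \tsum_(h1, h2 <- comul h) \tsum_(r1, r2 <- bcomul r)
      ((h1 \act r1) \ox (h2 \act r2));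
  bcomul_coact : forall r : R,
    \tsum_(h, r0 <- coact r) (h \ox bcomul r0) =
    \tsum_(r1, r2 <- bcomul r)
      \tsum_(g, s1 <- coact r1) \tsum_(h, s2 <- coact r2)
        ((g * h) \ox (s1 \ox s2));
  bcounit_act : forall (h : H) (r : R),
    bcounit (h \act r) = counit h * bcounit r;
  bcounit_coact : forall r : R,
    \tsum_(h, r0 <- coact r) (bcounit r0 *: h) = (bcounit r)%:A;
  bantipode_act : forall (h : H) (r : R),
    bantipode (h \act r) = h \act bantipode r;
  bantipode_coact : forall r : R,
    coact (bantipode r) = \tsum_(h, r0 <- coact r) (h \ox bantipode r0);
  bcomulA : forall r : R,
    \tsum_(x, y <- bcomul r) \tsum_(y1, y2 <- bcomul y) (x \ox (y1 \ox y2)) =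
    \tsum_(x, y <- bcomul r) \tsum_(x1, x2 <- bcomul x) (x1 \ox (x2 \ox y));
  bcounitKl : forall r : R, \tsum_(x, y <- bcomul r) (bcounit x *: y) = r;
  bcounitKr : forall r : R, \tsum_(x, y <- bcomul r) (bcounit y *: x) = r;
  bcomul1 : bcomul 1 = 1 \ox 1;
  bcomulM : forall r s : R,
    bcomul (r * s) =
    \tsum_(r1, r2 <- bcomul r) \tsum_(s1, s2 <- bcomul s)
      \tsum_(s1', r2' <- braiding r2 s1) ((r1 * s1') \ox (r2' * s2));
  bcounit1 : bcounit 1 = 1;
  bcounitM : forall r s : R, bcounit (r * s) = bcounit r * bcounit s;
  bantipodeKl : forall r : R,
    \tsum_(x, y <- bcomul r) (bantipode x * y) = (bcounit r)%:A;
  bantipodeKr : forall r : R,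
    \tsum_(x, y <- bcomul r) (x * bantipode y) = (bcounit r)%:A
}.

#[short(type="braidedHopfType")]
HB.structure Definition BraidedHopf (k : fieldType) (H : hopfAlgType k) :=
  {R of GRing.Algebra k R & YetterDrinfeld k H R & isBraidedHopf k H R}.

Section Gradings.
Context (k : fieldType).

Record is_grading (M : lmodType k) (G : nat -> M -> Prop) : Prop := {
  grading0 : forall n, G n 0;
  gradingP : forall n c x y, G n x -> G n y -> G n (c *: x + y);
  grading_sum : forall x, exists n (f : 'I_n -> M),
    (forall i : 'I_n, G i (f i)) /\ x = \sum_i f i;
  grading_direct : forall n (f : 'I_n -> M),
    (forall i : 'I_n, G i (f i)) -> \sum_i f i = 0 -> forall i, f i = 0
}.

Definition tens_span (U V : lmodType k) (P : U -> V -> Prop) :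
    U \ox V -> Prop :=
  lspan (fun t => exists u v, P u v /\ t = u \ox v).

Record is_hopf_grading (H : hopfAlgType k) (R : braidedHopfType H)
    (G : nat -> R -> Prop) : Prop := {
  hopf_grading : is_grading G;
  grading_act : forall n (h : H) r, G n r -> G n (h \act r);
  grading_coact : forall n r, G n r -> tens_span (fun _ => G n) (coact r);
  grading_1 : G 0 1;
  grading_mul : forall m n r s, G m r -> G n s -> G (m + n)%N (r * s);
  grading_counit : forall n r, (0 < n)%N -> G n r -> bcounit r = 0;
  grading_comul : forall n r, G n r ->
    tens_span (fun x y => exists i j, [/\ (i + j)%N = n, G i x & G j y])
      (bcomul r);
  grading_antipode : forall n r, G n r -> G n (bantipode r)
}.

Definition primitive (H : hopfAlgType k) (R : braidedHopfType H) (r : R) :=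
  bcomul r = r \ox 1 + 1 \ox r.

Definition subalg_gen (A : algType k) (P : A -> Prop) : A -> Prop :=
  lspan (fun x => exists2 s : seq A,
    forall y, y \in s -> P y & x = \prod_(y <- s) y).

(** [R] with the grading [G] is a Nichols algebra of [V], the isomorphism
    between [V] and the homogeneous component of degree 1 being [iota]. *)
Record is_Nichols (H : hopfAlgType k) (V : ydModType H) (R : braidedHopfType H)
    (G : nat -> R -> Prop) (iota : {linear V -> R}) : Prop := {
  Nichols_grading : is_hopf_grading G;
  Nichols_deg0 : forall r, G 0 r <-> exists c : k, r = c%:A;
  Nichols_iota_inj : injective iota;
  Nichols_deg1 : forall r, G 1 r <-> exists v, r = iota v;
  Nichols_iota_act : forall (h : H) v, iota (h \act v) = h \act iota v;
  Nichols_iota_coact : forall v,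
    coact (iota v) = \tsum_(h, w <- coact v) (h \ox iota w);
  Nichols_primitive : forall r, G 1 r <-> primitive r;
  Nichols_gen : forall r, subalg_gen (G 1) r
}.

End Gradings.

Notation free_alg k n := {malg k[{fmonom 'I_n}]}.

Section Presentations.
Context (k : fieldType).

Definition fvar n (i : 'I_n) : free_alg k n := << fmu i >>.

Definition free_eval n (A : algType k) (g : 'I_n -> A) (p : free_alg k n) : A :=
  \sum_(w <- msupp p) p@_w *: \prod_(i <- (w : seq 'I_n)) g i.

Definition ideal_gen n (rels : seq (free_alg k n)) : free_alg k n -> Prop :=
  lspan (fun z => exists u r v, r \in rels /\ z = u * r * v).

Definition presented_by n (A : algType k) (g : 'I_n -> A)
    (rels : seq (free_alg k n)) : Prop :=
  (forall x, exists p, free_eval g p = x) /\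
  (forall p, free_eval g p = 0 <-> ideal_gen rels p).

End Presentations.

Definition relK (k : fieldType) (xi : k) : seq (free_alg k 4) :=
  let a : free_alg k 4 := fvar k (inord 0) in
  let b : free_alg k 4 := fvar k (inord 1) in
  let c : free_alg k 4 := fvar k (inord 2) in
  let d : free_alg k 4 := fvar k (inord 3) in
  [:: a * b - xi *: (b * a); a * c - xi *: (c * a); c * b; b * c;
      c * d - xi *: (d * c); b * d - xi *: (d * b); a * d - d * a; a * d - 1;
      b ^+ 2; c ^+ 2; a ^+ 2 * c - b; a ^+ 4 - 1].

(** The dimension 8 of [K] is not assumed, as it follows from [K_presented]. *)
Record is_K (k : fieldType) (xi : k) (K : hopfAlgType k) (a b c d : K) :
    Prop := {
  K_presented : presented_by (tnth [tuple a; b; c; d]) (relK xi);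
  K_comul : [/\ comul a = a \ox a + b \ox c, comul b = a \ox b + b \ox d,
                comul c = c \ox a + d \ox c & comul d = c \ox b + d \ox d];
  K_counit : [/\ counit a = 1, counit b = 0, counit c = 0 & counit d = 1];
  K_antipode : [/\ antipode a = d, antipode b = xi *: b,
                   antipode c = - (xi *: c) & antipode d = a]
}.

(** [V] is the module [V_{i,1}] and [l] is the scalar lambda of its definition. *)
Record is_V1 (k : fieldType) (xi : k) (K : hopfAlgType k) (a b c d : K)
    (i : 'Z_4) (V : ydModType K) (e1 e2 : V) : Prop := {
  V1_basis : forall v, exists! s : k * k, v = s.1 *: e1 + s.2 *: e2;
  V1_act1 : let l := xi ^+ i in
    [/\ a \act e1 = l *: e1, b \act e1 = 0, c \act e1 = 0
      & d \act e1 = l^-1 *: e1];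
  V1_act2 : let l := xi ^+ i in
    [/\ a \act e2 = - (xi * l) *: e2, b \act e2 = l ^+ 2 *: e1,
        c \act e2 = e1 & d \act e2 = (xi * l^-1) *: e2];
  V1_coact : let l := xi ^+ i in
    coact e1 = d \ox e1 + ((l ^+ 3 - xi * l) *: c) \ox e2 /\
    coact e2 = a \ox e2 + ((2%:R^-1 * (l + xi * l ^+ 3)) *: b) \ox e1
}.

(* Main.v *)
Require Import Defs.
From HB Require Import structures.
From mathcomp Require Import all_boot all_order all_algebra.
From mathcomp Require Import finmap monalg ring boolp.

Set Implicit Arguments.
Unset Strict Implicit.
Unset Printing Implicit Defensive.

Import GRing.Theory.
Local Open Scope ring_scope.

(** Write [x], [y] for the images of [e1], [e2] in the Nichols algebra [B]; they
    are primitive of degree 1 and generate [B].  The braiding gives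
      [c(x#x) = - x#x],          [c(x#y) = - xi y#x + (xi - 1) x#y],
      [c(y#x) = - x#y],          [c(y#y) = xi y#y + beta x#x]
    (with # for the tensor sign and [beta = - (1 + xi)/2]).

    Relations.  In a Nichols algebra a primitive element that is homogeneous of
    degree at least 2 is zero ([primitive_eq0]).  The coproduct of a product
    [r s] with [r] primitive is a linear function of the coproduct of [s] alone
    ([bcomul_primitiveM]), so the coproducts of [x^2], [xy + xi yx] and [y^4]
    are computed by multiplying by one generator at a time; all three elements
    turn out to be primitive ([x2_primitive], [xy_primitive], [y4_primitive]).
    For [y^4] the reason is that [1 + xi + xi^2 + xi^3 = 0].

    Spanning.  Modulo the ideal of the three relations every noncommutative
    polynomial is a combination of the eight monomials [x^i y^j], [i < 2],
    [j < 4] ([normalizable_all]).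

    Independence.  A linear form on [V], extended to [B] through the degree 1
    component, is a derivation relative to the counit ([degree1_formM]).
    Contracting the right factor of the coproduct with such a form is a skew
    derivation of [B] ([contraction_primitiveM]).  With [D1], [D2] the skew
    derivations attached to the two coordinates of [V], the eight linear forms
    [eps o D2^j o D1^i] are diagonal on the eight monomials, with entries
    products of powers of [- xi] and of the xi-integers [1], [1 + xi], [xi], all
    nonzero ([dual_monomialE], [dual_coef_neq0]).

    Hence the monomials form a basis of [B], of dimension 8.  A polynomial that
    vanishes in [B] has a normal form that vanishes in [B], so all coefficients
    of the normal form are zero and the polynomial lies in the ideal. *)

(** * Tensors, actions, and multiplication by a primitive element *)

Section Tsum.
Context (k : fieldType) (U V : lmodType k).
Implicit Types (t : (U \ox V)%type).

Lemma eq_tsum t (W : lmodType k) (f g : U -> V -> W) :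
  (forall u v, f u v = g u v) -> tsum t f = tsum t g.
Proof. by move=> fg; apply: eq_bigr => p _; rewrite fg. Qed.

Lemma tsumDr t (W : lmodType k) (f g : U -> V -> W) :
  tsum t (fun u v => f u v + g u v) = tsum t f + tsum t g.
Proof.
rewrite /tsum /free_sum -big_split; apply: eq_bigr => p _ /=.
by rewrite scalerDr.
Qed.

Lemma linear_tsum t (W W' : lmodType k) (L : W -> W') (f : U -> V -> W) :
  linear L -> L (tsum t f) = tsum t (fun u v => L (f u v)).
Proof.
move=> linL; pose g : {linear W -> W'} := HB.pack L
  (GRing.isLinear.Build k W W' *:%R L linL).
rewrite /tsum /free_sum -[L]/(g : W -> W') raddf_sum; apply: eq_bigr => p _ /=.
exact: (linearZ_LR g).
Qed.

Lemma linear_tsum_fun t (W W' : lmodType k) (f : W' -> U -> V -> W) :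
  (forall u v, linear (fun w => f w u v)) -> linear (fun w => tsum t (f w)).
Proof.
move=> lf c w w'; rewrite /tsum /free_sum scaler_sumr -big_split.
apply: eq_bigr => p _ /=.
by rewrite lf scalerDr !scalerA mulrC.
Qed.

Lemma tsumD t t' (W : lmodType k) (f : U -> V -> W) :
  (forall v, linear (f^~ v)) -> (forall u, linear (f u)) ->
  tsum (t + t') f = tsum t f + tsum t' f.
Proof.
by move=> fl fr; have := tsum_is_linear fl fr 1 t t'; rewrite !scale1r.
Qed.

Lemma tsum_tens2 u v u' v' (W : lmodType k) (f : U -> V -> W) :
  (forall v, linear (f^~ v)) -> (forall u, linear (f u)) ->
  tsum (u \ox v + u' \ox v') f = f u v + f u' v'.
Proof. by move=> fl fr; rewrite tsumD // !tsum_tens. Qed.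

End Tsum.

Section Action.
Context (k : fieldType) (H : hopfAlgType k) (M : ydModType H).

Lemma actDl (g h : H) (m : M) : (g + h) \act m = g \act m + h \act m.
Proof. by have := act_linearl m 1 g h; rewrite !scale1r. Qed.

Lemma actDr (h : H) (m n : M) : h \act (m + n) = h \act m + h \act n.
Proof. by have := act_linearr h 1 m n; rewrite !scale1r. Qed.

Lemma act0r (h : H) : h \act (0 : M) = 0.
Proof. by apply: (addrI (h \act 0)); rewrite -actDr !addr0. Qed.

Lemma act0l (m : M) : (0 : H) \act m = 0.
Proof. by apply: (addrI (0 \act m)); rewrite -actDl !addr0. Qed.

Lemma actZl c (h : H) (m : M) : (c *: h) \act m = c *: (h \act m).
Proof. by have := act_linearl m c h 0; rewrite !addr0 act0l addr0. Qed.

Lemma actZr c (h : H) (m : M) : h \act (c *: m) = c *: (h \act m).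
Proof. by have := act_linearr h c m 0; rewrite !addr0 act0r addr0. Qed.

HB.instance Definition _ (h : H) := GRing.isLinear.Build k M M *:%R (act h)
  (act_linearr h).

End Action.

Definition linE := (actDl, actDr, actZl, actZr, mulrDl, mulrDr, tensDl, tensDr,
  tensZl, tensZr).

Section Primitive.
Context (k : fieldType) (H : hopfAlgType k) (R : braidedHopfType H).
Implicit Types (r s : R).

(** For [r] primitive, the coproduct of [r s] is the product of [r # 1 + 1 # r]
    with the coproduct of [s] in the braided tensor square; moving [r] past the
    left factor of the latter costs one application of the braiding. *)
Lemma bcomul_primitiveM r s : primitive r ->
  bcomul (r * s) = \tsum_(u, v <- bcomul s)
    ((r * u) \ox v + \tsum_(h, r0 <- coact r) ((h \act u) \ox (r0 * v))).
Proof.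
move=> r_prim; rewrite bcomulM r_prim.
have inner_l r1 v : forall w : R, linear (fun u : R => (r1 * u) \ox (w * v)).
  by move=> w c u u'; rewrite !linE -scalerAr tensZl.
have inner_r r1 v : forall u : R, linear (fun w : R => (r1 * u) \ox (w * v)).
  by move=> u c w w'; rewrite !linE -scalerAl tensZr.
have br_l s1 : forall m : R, linear (fun h : H => (h \act s1) \ox m).
  by move=> m c h h'; rewrite !linE.
have br_r s1 : forall h : H, linear (fun m : R => (h \act s1) \ox m).
  by move=> h c m m'; rewrite !linE.
pose F r1 r2 := \tsum_(s1, s2 <- bcomul s)
  \tsum_(s1', r2' <- braiding r2 s1) ((r1 * s1') \ox (r2' * s2)).
have Fl r2 : linear (F^~ r2).
  apply: linear_tsum_fun => u v; apply: linear_tsum_fun => w w' c x y.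
  by rewrite !linE -scalerAl tensZl.
have Fr r1 : linear (F r1).
  apply: linear_tsum_fun => u v c r2 r2'.
  by rewrite /braiding linearP !tsum_is_linear.
rewrite (tsum_tens2 _ _ _ _ Fl Fr) /F -tsumDr.
apply: eq_tsum => u v; rewrite /braiding coactr1 !tsum_tens //.
rewrite act_1 mul1r; congr (_ + _).
rewrite (linear_tsum _ _ (L := fun t => \tsum_(u', r' <- t) ((1 * u') \ox (r' * v)))).
  by apply: eq_tsum => h r0; rewrite tsum_tens // mul1r.
exact: tsum_is_linear.
Qed.

(** Left multiplication by [r # 1 + 1 # r] in the braided tensor square. *)
Definition primitive_left r (t : (R \ox R)%type) : (R \ox R)%type :=
  \tsum_(u, v <- t)
    ((r * u) \ox v + \tsum_(h, r0 <- coact r) ((h \act u) \ox (r0 * v))).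

Lemma primitive_left_l r v : linear (fun u : R =>
  (r * u) \ox v + \tsum_(h, r0 <- coact r) ((h \act u) \ox (r0 * v))).
Proof.
move=> z u u'; rewrite !linE -scalerAr tensZl scalerDr.
rewrite (linear_tsum_fun _ (f := fun u h r0 => (h \act u) \ox (r0 * v))).
  by rewrite [RHS]addrACA.
by move=> h r0 w s s'; rewrite !linE.
Qed.

Lemma primitive_left_r r u : linear (fun v : R =>
  (r * u) \ox v + \tsum_(h, r0 <- coact r) ((h \act u) \ox (r0 * v))).
Proof.
move=> z v v'; rewrite tensDr tensZr scalerDr.
rewrite (linear_tsum_fun _ (f := fun v h r0 => (h \act u) \ox (r0 * v))).
  by rewrite [RHS]addrACA.
by move=> h r0 w s s'; rewrite mulrDr -scalerAr tensDr tensZr.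
Qed.

Lemma primitive_left_is_linear r : linear (primitive_left r).
Proof. exact: tsum_is_linear (primitive_left_l r) (primitive_left_r r). Qed.

HB.instance Definition _ r := GRing.isLinear.Build k _ _ *:%R (primitive_left r)
  (primitive_left_is_linear r).

Lemma primitive_left_tens r u v (h1 h2 : H) r1 r2 :
  coact r = h1 \ox r1 + h2 \ox r2 ->
  primitive_left r (u \ox v) = (r * u) \ox v +
    ((h1 \act u) \ox (r1 * v) + (h2 \act u) \ox (r2 * v)).
Proof.
move=> rE; rewrite /primitive_left.
rewrite (tsum_tens (primitive_left_l r) (primitive_left_r r)) rE.
have fl w : linear (fun h : H => (h \act u) \ox (w * v)).
  by move=> z h h'; rewrite actDl actZl tensDl tensZl.
have fr h : linear (fun w : R => (h \act u) \ox (w * v)).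
  by move=> z w w'; rewrite mulrDl -scalerAl tensDr tensZr.
by rewrite (tsum_tens2 _ _ _ _ fl fr).
Qed.

(** The counit axiom applied to [r # 1 + 1 # r] reads [bcounit r *: 1 + r = r]. *)
Lemma bcounit_primitive r : primitive r -> bcounit r = 0.
Proof.
move=> r_prim; have el : forall v : R, linear (fun u : R => bcounit u *: v).
  by move=> v c u u'; rewrite linearP scalerDl scalerA.
have er : forall u : R, linear (fun v : R => bcounit u *: v).
  by move=> u c v v'; rewrite scalerDr !scalerA mulrC.
have := bcounitKl r; rewrite r_prim (tsum_tens2 _ _ _ _ el er).
rewrite bcounit1 scale1r -[RHS]add0r => /addIr /(congr1 bcounit).
by rewrite linearZ_LR /= bcounit1 mulr1 linear0.
Qed.

(** For [f] a derivation relative to the counit this is the skew derivation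
    attached to [f]. *)
Definition contraction (f : R -> k) r : R :=
  \tsum_(u, v <- bcomul r) (f v *: u).

Section Contraction.
Variable f : {scalar R}.

Lemma contraction_l : forall v : R, linear (fun u : R => f v *: u).
Proof. by move=> v c u u'; rewrite scalerDr !scalerA mulrC. Qed.

Lemma contraction_r : forall u : R, linear (fun v : R => f v *: u).
Proof. by move=> u c v v'; rewrite linearP scalerDl scalerA. Qed.

Lemma contraction_is_linear : linear (contraction f).
Proof.
move=> c r s; rewrite /contraction linearP tsum_is_linear //.
  exact: contraction_l.
exact: contraction_r.
Qed.

HB.instance Definition _ := GRing.isLinear.Build k R R *:%R (contraction f)
  contraction_is_linear.

Lemma contraction1 : f 1 = 0 -> contraction f 1 = 0.
Proof.
move=> f1; rewrite /contraction bcomul1.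
by rewrite (tsum_tens contraction_l contraction_r) f1 scale0r.
Qed.

(** The skew Leibniz rule.  In [f (r0 * v)] the derivation property of [f]
    leaves a term [f r0 * bcounit v], which collapses the coproduct of [s] to
    [s], and a term [bcounit r0 * f v], which vanishes because the counit is
    colinear and kills primitive elements. *)
Lemma contraction_primitiveM r s : primitive r ->
  (forall u v, f (u * v) = f u * bcounit v + bcounit u * f v) ->
  contraction f (r * s) = r * contraction f s +
    \tsum_(h, r0 <- coact r) (f r0 *: (h \act s)).
Proof.
move=> r_prim fder; have r0 := bcounit_primitive r_prim.
rewrite /contraction (bcomul_primitiveM _ r_prim).
pose D (t : (R \ox R)%type) := \tsum_(u, v <- t) (f v *: u).
have linD : linear D := tsum_is_linear contraction_l contraction_r.
rewrite -/(D _) (linear_tsum _ _ linD).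
have DD x y : D (x + y) = D x + D y by have := linD 1 x y; rewrite !scale1r.
have DE u v : D (u \ox v) = f v *: u by exact: tsum_tens contraction_l contraction_r _ _.
under eq_tsum => u v.
  rewrite DD DE (linear_tsum _ _ linD) scalerAr.
  under eq_tsum => h x do rewrite DE fder scalerDl -scalerA.
  over.
rewrite tsumDr; congr (_ + _).
  by rewrite (linear_tsum _ _ (L := fun z => r * z)) // => c u u'; rewrite linE -scalerAr.
pose L (u : R) := \tsum_(h, x <- coact r) (f x *: (h \act u)).
have linL : linear L.
  by apply: linear_tsum_fun => h x c u u'; rewrite !linE scalerDr !scalerA mulrC.
rewrite -[RHS]/(L s) -{2}(bcounitKr s) (linear_tsum _ _ linL).
apply: eq_tsum => u v; rewrite tsumDr [X in _ + X](_ : _ = 0) ?addr0.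
  by apply: eq_tsum => h x; rewrite actZr.
pose N h := f v *: (h \act u).
have linN : linear N by move=> c h h'; rewrite /N !linE scalerDr !scalerA mulrC.
transitivity (N (\tsum_(h, x <- coact r) (bcounit x *: h))).
  rewrite (linear_tsum _ _ linN); apply: eq_tsum => h x.
  by rewrite /N actZl scalerA mulrC.
by rewrite bcounit_coact r0 scale0r /N act0l scaler0.
Qed.

Lemma contraction_primitiveM2 r s (h1 h2 : H) r1 r2 : primitive r ->
  (forall u v, f (u * v) = f u * bcounit v + bcounit u * f v) ->
  coact r = h1 \ox r1 + h2 \ox r2 ->
  contraction f (r * s) =
    r * contraction f s + (f r1 *: (h1 \act s) + f r2 *: (h2 \act s)).
Proof.
move=> r_prim fder rE; rewrite contraction_primitiveM // rE; congr (_ + _).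
have fl w : linear (fun h : H => f w *: (h \act s)).
  by move=> z h h'; rewrite actDl actZl scalerDr !scalerA mulrC.
have fr h : linear (fun w : R => f w *: (h \act s)).
  by move=> z w w'; rewrite linearP scalerDl scalerA.
by rewrite (tsum_tens2 _ _ _ _ fl fr).
Qed.

End Contraction.

Lemma act_mul2 (h h1 h2 h3 h4 : H) r s :
  comul h = h1 \ox h2 + h3 \ox h4 ->
  h \act (r * s) = (h1 \act r) * (h2 \act s) + (h3 \act r) * (h4 \act s).
Proof.
move=> hE; rewrite actrM hE.
have fl v : linear (fun u : H => (u \act r) * (v \act s)).
  by move=> z u u'; rewrite actDl actZl mulrDl -scalerAl.
have fr u : linear (fun v : H => (u \act r) * (v \act s)).
  by move=> z v v'; rewrite actDl actZl mulrDr -scalerAr.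
by rewrite (tsum_tens2 _ _ _ _ fl fr).
Qed.

End Primitive.

(** * Homogeneous components *)

Section Grading.
Context (k : fieldType) (M : lmodType k) (G : nat -> M -> Prop).
Hypothesis G_grading : is_grading G.

Lemma gradingZ n c x : G n x -> G n (c *: x).
Proof.
move=> Gx; rewrite -[c *: x]addr0.
by apply: (gradingP G_grading) => //; exact: (grading0 G_grading).
Qed.

Lemma gradingB n x y : G n x -> G n y -> G n (x - y).
Proof.
by move=> Gx Gy; rewrite addrC -scaleN1r; apply: (gradingP G_grading).
Qed.

Lemma gradingD n x y : G n x -> G n y -> G n (x + y).
Proof. by move=> Gx Gy; rewrite -[x]scale1r; apply: (gradingP G_grading). Qed.

(** The sequences of components are indexed by all of [nat] and only their long
    enough partial sums are required to equal [x]: two decompositions of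
    different lengths can then be compared term by term. *)
Definition homogeneous_family x (f : nat -> M) :=
  (forall i, G i (f i)) /\ exists N, forall n, (N <= n)%N -> x = \sum_(i < n) f i.

Lemma homogeneous_family_ex x : exists f, homogeneous_family x f.
Proof.
have [n [f [Gf ->]]] := grading_sum G_grading x.
pose g i := if insub i is Some j then f j else 0.
have gE (i : 'I_n) : g i = f i by rewrite /g valK.
exists g; split=> [i|].
  rewrite /g; case: insubP => [j _ <-|_]; [exact: Gf | exact: grading0].
exists n => m le_nm; rewrite (eq_bigr (fun i : 'I_n => g i)) => [|i _]; last first.
  by rewrite gE.
rewrite (big_ord_widen m g le_nm) [RHS](bigID (fun i : 'I_m => (i < n)%N)) /=.
rewrite [X in _ = _ + X]big1 ?addr0 // => i /negPf ni.
by rewrite /g insubF.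
Qed.

Lemma homogeneous_family_uniq x f g :
  homogeneous_family x f -> homogeneous_family x g -> f =1 g.
Proof.
move=> [Gf [m xf]] [Gg [n xg]] i; apply/eqP; rewrite -subr_eq0; apply/eqP.
pose N := maxn (maxn m n) i.+1.
have lt_iN : (i < N)%N by rewrite leq_max leqnn orbT.
apply: (grading_direct G_grading (f := fun j : 'I_N => f j - g j)
  _ _ (Ordinal lt_iN)) => [j|].
  exact: gradingB.
rewrite sumrB -xf -?xg ?subrr // /N !leq_max ?leqnn ?orbT //.
Qed.

Definition component n x : M := projT1 (cid (homogeneous_family_ex x)) n.

Lemma componentE x f : homogeneous_family x f -> component^~ x =1 f.
Proof.
move=> xf n; rewrite /component; case: cid => g xg /=.
exact: homogeneous_family_uniq xg xf n.
Qed.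

Lemma component_hom x : homogeneous_family x (component^~ x).
Proof.
by have [f xf] := homogeneous_family_ex x; rewrite (funext (componentE xf)).
Qed.

Lemma component_deg n x : G n x -> component n x = x.
Proof.
move=> Gx; rewrite (@componentE x (fun i => if i == n then x else 0)) ?eqxx //.
split=> [i|]; first by case: eqP => [-> //|_]; exact: grading0.
exists n.+1 => m lt_nm; rewrite (bigD1 (Ordinal lt_nm)) //= eqxx big1 ?addr0 //.
by move=> i /negPf; rewrite -val_eqE /= => ->.
Qed.

Lemma component_other m n x : G m x -> m != n -> component n x = 0.
Proof.
move=> Gx ne_mn; rewrite (@componentE x (fun i => if i == m then x else 0)).
  by rewrite eq_sym (negPf ne_mn).
split=> [i|]; first by case: eqP => [-> //|_]; exact: grading0.
exists m.+1 => p lt_mp; rewrite (bigD1 (Ordinal lt_mp)) //= eqxx big1 ?addr0 //.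
by move=> i /negPf; rewrite -val_eqE /= => ->.
Qed.

Lemma component_is_linear n : linear (component n).
Proof.
move=> c x y; have [Gx [nx xE]] := component_hom x.
have [Gy [ny yE]] := component_hom y.
apply: (@componentE _ (fun i => c *: component i x + component i y)).
split=> [i|]; first exact: gradingP.
exists (maxn nx ny) => m; rewrite geq_max => /andP[lx ly].
by rewrite big_split -scaler_sumr -xE // -yE.
Qed.

End Grading.

(** * Degree-one forms on a Nichols algebra *)

Section Nichols.
Context (k : fieldType) (H : hopfAlgType k) (V : ydModType H)
  (B : braidedHopfType H) (G : nat -> B -> Prop) (iota : {linear V -> B}).
Hypothesis B_nichols : is_Nichols G iota.

Let G_hopf := Nichols_grading B_nichols.
Let G_grading := hopf_grading G_hopf.

Lemma grading_disjoint m n x : m != n -> G m x -> G n x -> x = 0.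
Proof.
move=> ne_mn Gm Gn; rewrite -(component_deg G_grading Gn).
exact: component_other ne_mn.
Qed.

Lemma grading_ind (P : B -> Prop) :
  P 0 -> (forall x y, P x -> P y -> P (x + y)) ->
  (forall n x, G n x -> P x) -> forall x, P x.
Proof.
move=> P0 PD PG x; have [n [f [Gf ->]]] := grading_sum G_grading x.
by elim/big_rec: _ => // i y _ Py; apply: PD => //; apply: PG (Gf i).
Qed.

Lemma iota_deg1 v : G 1 (iota v).
Proof. by apply/(Nichols_deg1 B_nichols); exists v. Qed.

Lemma iota_primitive v : primitive (iota v).
Proof. by apply/(Nichols_primitive B_nichols); exact: iota_deg1. Qed.

(** The source of all relations: primitive elements live in degree 1 only. *)
Lemma primitive_eq0 n x : G n x -> n != 1%N -> primitive x -> x = 0.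
Proof.
by move=> Gx n1 /(Nichols_primitive B_nichols); apply: grading_disjoint n1 Gx.
Qed.

Definition coord1 (x : B) : V :=
  projT1 (cid (proj1 (Nichols_deg1 B_nichols (component G_grading 1 x))
    (proj1 (component_hom G_grading x) 1%N))).

Lemma coord1K x : iota (coord1 x) = component G_grading 1 x.
Proof. by rewrite /coord1; case: cid => v /= ->. Qed.

Lemma coord1_is_linear : linear coord1.
Proof.
move=> c x y; apply: (Nichols_iota_inj B_nichols).
by rewrite linearP !coord1K component_is_linear.
Qed.

HB.instance Definition _ := GRing.isLinear.Build k B V *:%R coord1
  coord1_is_linear.

Lemma coord1_iota v : coord1 (iota v) = v.
Proof.
apply: (Nichols_iota_inj B_nichols).
by rewrite coord1K component_deg //; exact: iota_deg1.
Qed.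

Lemma coord1_other n x : G n x -> n != 1%N -> coord1 x = 0.
Proof.
move=> Gx n1; apply: (Nichols_iota_inj B_nichols).
by rewrite coord1K linear0; exact: component_other Gx n1.
Qed.

(** Both sides are bilinear, so homogeneous factors suffice.  Two factors of
    positive degree have a product of degree at least 2 and both sides vanish; a
    factor of degree 0 is a scalar, equal to its counit. *)
Lemma coord1_derivation x y :
  coord1 (x * y) = bcounit y *: coord1 x + bcounit x *: coord1 y.
Proof.
elim/grading_ind: x y => [y|x x' IHx IHx' y|m x Gx y].
- by rewrite mul0r !linear0 ?scaler0 scale0r addr0.
- by rewrite mulrDl !linearD /=; rewrite IHx IHx' scalerDl addrACA.
elim/grading_ind: y => [|y y' IHy IHy'|n y Gy].
- by rewrite mulr0 !linear0 ?scaler0 scale0r addr0.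
- by rewrite mulrDr !linearD /= IHy IHy' scalerDl addrACA.
have eps n' (z : B) : (0 < n')%N -> G n' z -> bcounit z = 0.
  exact: (grading_counit G_hopf).
have coord0 z : G 0 z -> coord1 z = 0 by move=> Gz; exact: coord1_other Gz _.
have [m0|m_gt0] := posnP m.
  move: Gx; rewrite m0 => Gx; rewrite (coord0 _ Gx) scaler0 add0r.
  have [c ->] := proj1 (Nichols_deg0 B_nichols x) Gx.
  by rewrite -scalerAl mul1r !linearZ_LR /= bcounit1 mulr1.
have [n0|n_gt0] := posnP n.
  move: Gy; rewrite n0 => Gy; rewrite (coord0 _ Gy) scaler0 addr0.
  have [c ->] := proj1 (Nichols_deg0 B_nichols y) Gy.
  by rewrite -scalerAr mulr1 !linearZ_LR /= bcounit1 mulr1.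
rewrite (eps _ _ m_gt0 Gx) (eps _ _ n_gt0 Gy) !scale0r addr0.
apply: coord1_other (grading_mul G_hopf Gx Gy) _.
by rewrite -(prednK m_gt0) -(prednK n_gt0) addSn addnS.
Qed.

Definition degree1_form (phi : {scalar V}) (x : B) : k := phi (coord1 x).

Lemma degree1_form_is_scalar phi : scalar (degree1_form phi).
Proof. by move=> z x y; rewrite /degree1_form !linearP. Qed.

HB.instance Definition _ phi := GRing.isLinear.Build k B k *%R (degree1_form phi)
  (degree1_form_is_scalar phi).

Lemma degree1_form_iota phi v : degree1_form phi (iota v) = phi v.
Proof. by rewrite /degree1_form coord1_iota. Qed.

Lemma degree1_form1 phi : degree1_form phi 1 = 0.
Proof.
rewrite /degree1_form (coord1_other (n := 0)) ?linear0 //.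
exact: grading_1 G_hopf.
Qed.

Lemma degree1_formM phi x y : degree1_form phi (x * y) =
  degree1_form phi x * bcounit y + bcounit x * degree1_form phi y.
Proof.
rewrite /degree1_form coord1_derivation linearD !linearZ_LR /=.
by rewrite [bcounit y * _]mulrC.
Qed.

Lemma Nichols_ind (P : B -> Prop) :
  (forall c x y, P x -> P y -> P (c *: x + y)) -> P 1 ->
  (forall v x, P x -> P (iota v * x)) -> forall x, P x.
Proof.
move=> PD P1 PM x; have [s Ps ->] := Nichols_gen B_nichols x.
have P0 : P 0 by have := PD (-1) 1 1 P1 P1; rewrite scaleN1r addNr.
rewrite big_seq; elim/big_rec: _ => // p y /Ps [t Gt ->] Py; apply: PD => //.
elim: t Gt => [|z t IHt] Gt; first by rewrite big_nil.
have [v ->] := proj1 (Nichols_deg1 B_nichols z) (Gt z (mem_head _ _)).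
rewrite big_cons; apply: PM; apply: IHt => w wt; apply: Gt.
by rewrite inE wt orbT.
Qed.

End Nichols.

(** * Evaluation of noncommutative polynomials *)

Lemma lspan_map (k : nzRingType) (M N : lmodType k) (L : M -> N)
    (P : M -> Prop) (Q : N -> Prop) z : linear L ->
  (forall y, P y -> Q (L y)) -> lspan P z -> lspan Q (L z).
Proof.
move=> linL PQ [s Ps ->]; pose g : {linear M -> N} := HB.pack L
  (GRing.isLinear.Build k M N *:%R L linL).
exists [seq (p.1, L p.2) | p <- s]; first by move=> p /mapP[q /Ps/PQ Qq ->].
rewrite big_map -[L]/(g : M -> N) linear_sum; apply: eq_bigr => p _.
by rewrite linearZ_LR.
Qed.

Section FreeEval.
Context (k : fieldType) (n : nat) (A : algType k) (g : 'I_n -> A).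
Local Notation F := (free_alg k n).

Lemma free_evalEw (d : {fset {fmonom 'I_n}}) (p : F) : (msupp p `<=` d)%fset ->
  free_eval g p = \sum_(w <- d) p@_w *: \prod_(i <- (w : seq 'I_n)) g i.
Proof.
move=> le_d; rewrite /free_eval (big_fset_incl _ le_d) //= => w _ hw.
by rewrite mcoeff_outdom ?scale0r.
Qed.

Lemma free_eval_is_linear : linear (free_eval g : F -> A).
Proof.
move=> c x y; pose d := (msupp (c *: x + y) `|` (msupp x `|` msupp y))%fset.
rewrite !(@free_evalEw d) ?fsubsetUl //; first last.
- by rewrite /d fsetUCA fsubsetUl.
- by rewrite /d fsetUA fsubsetUr.
rewrite scaler_sumr -big_split; apply: eq_bigr => p _ /=.
by rewrite mcoeffD mcoeffZ scalerDl scalerA.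
Qed.

HB.instance Definition _ := GRing.isLinear.Build k F A *:%R (free_eval g)
  free_eval_is_linear.

Lemma free_evalD : {morph free_eval g : p q / p + q >-> p + q}.
Proof. exact: linearD. Qed.

Lemma free_evalZ c : {morph free_eval g : p / c *: p >-> c *: p}.
Proof. exact: linearZ_LR. Qed.

Lemma free_evalU c w :
  free_eval g << c *g w >> = c *: \prod_(i <- (w : seq 'I_n)) g i.
Proof. by rewrite (@free_evalEw [fset w]%fset) ?msuppU_le // big_seq_fset1 mcoeffUU. Qed.

Lemma free_eval_var i : free_eval g (fvar k i) = g i.
Proof. by rewrite free_evalU scale1r fmU big_seq1. Qed.

Lemma free_eval1 : free_eval g 1 = 1.
Proof. by rewrite free_evalU scale1r fm1 big_nil. Qed.

Lemma free_evalM : {morph free_eval g : p q / p * q}.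
Proof.
move=> p q; rewrite malgME linear_sum [X in _ = X * _]/free_eval mulr_suml.
apply: eq_bigr => w _; rewrite linear_sum [X in _ = _ * X]/free_eval mulr_sumr.
apply: eq_bigr => w' _ /=; rewrite free_evalU fmM big_cat /=.
by rewrite -scalerAr -scalerAl scalerA mulrC.
Qed.

Lemma free_evalMvar i j : free_eval g (fvar k i * fvar k j) = g i * g j.
Proof. by rewrite free_evalM !free_eval_var. Qed.

HB.instance Definition _ := GRing.isMonoidMorphism.Build F A (free_eval g)
  (conj free_eval1 free_evalM).

Lemma free_alg_ind (P : F -> Prop) :
  P 0 -> (forall c p q, P p -> P q -> P (c *: p + q)) ->
  P 1 -> (forall i p, P p -> P (fvar k i * p)) -> forall p, P p.
Proof.
move=> P0 PD P1 PM p; rewrite [p]monalgE; elim/big_rec: _ => // w q _ Pq.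
have -> : << p@_w *g w >> = p@_w *: (<< w >> : F).
  by apply/malgP => w'; rewrite mcoeffZ !mcoeffU mulrnAr mulr1.
apply: PD => //; case: w => s; elim: s => [|i s Ps].
  suff -> : FMonom [::] = mone :> {fmonom 'I_n} by exact: P1.
  by rewrite -[RHS]fmK fm1.
have -> : << FMonom (i :: s) >> = fvar k i * << FMonom s >> :> F; last exact: PM.
rewrite /fvar malgM_def fgmulUU mulr1; congr << _ >>.
by rewrite -[RHS]fmK fmM fmU.
Qed.

End FreeEval.

Section Ideal.
Context (k : fieldType) (n : nat) (rels : seq (free_alg k n)).
Local Notation F := (free_alg k n).
Local Notation I := (ideal_gen rels).

Lemma ideal_mem r : r \in rels -> I r.
Proof.
by move=> r_rel; apply: lspan_sub; exists 1, r, 1; rewrite mul1r mulr1.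
Qed.

(** Scalars are central because the coefficient ring is commutative. *)
Lemma free_alg_scalerAr c (u p : F) : u * (c *: p) = c *: (u * p).
Proof.
rewrite -(mul_malgC c p) -(mul_malgC c (u * p)) !mulrA; congr (_ * p).
rewrite !malgM_def fgmulgU fgmulUg; apply: eq_bigr => w _.
by rewrite mulrC mul1m mulm1.
Qed.

Lemma ideal_mull (u p : F) : I p -> I (u * p).
Proof.
apply: (lspan_map (L := fun p => u * p)) => [c x y|_ [v [r [w [r_rel ->]]]]].
  by rewrite mulrDr free_alg_scalerAr.
by exists (u * v), r, w; rewrite !mulrA.
Qed.

Lemma ideal_mulr (u p : F) : I p -> I (p * u).
Proof.
apply: (lspan_map (L := fun p => p * u)) => [c x y|_ [v [r [w [r_rel ->]]]]].
  by rewrite mulrDl -scalerAl.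
by exists v, r, (w * u); rewrite !mulrA.
Qed.

Lemma free_eval_ideal (A : algType k) (g : 'I_n -> A) p :
  (forall r, r \in rels -> free_eval g r = 0) -> I p -> free_eval g p = 0.
Proof.
move=> rels0; apply: lspan_ker => _ [u [r [v [r_rel ->]]]].
by rewrite /= !free_evalM (rels0 r r_rel) mulr0 mul0r.
Qed.

End Ideal.

(** * Dual families *)

Section DualBasis.
Context (k : fieldType) (n : nat) (A : lmodType k).
Variables (w : 'I_n -> A) (phi : 'I_n -> {scalar A}) (q : 'I_n -> k).
Hypotheses (q_neq0 : forall i, q i != 0).
Hypothesis phi_w : forall i j, phi i (w j) = q i *+ (i == j).
Hypothesis w_span : forall x, exists c : 'I_n -> k, x = \sum_i c i *: w i.

Lemma phi_sum (c : 'I_n -> k) i : phi i (\sum_j c j *: w j) = c i * q i.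
Proof.
rewrite linear_sum (bigD1 i) //= linearZ_LR /= phi_w eqxx.
rewrite big1 ?addr0 // => j ne_ji.
by rewrite linearZ_LR /= phi_w eq_sym (negPf ne_ji) mulr0.
Qed.

Lemma dual_basis_free (c : 'I_n -> k) : \sum_j c j *: w j = 0 -> forall i, c i = 0.
Proof.
move=> c0 i; have /eqP := phi_sum c i.
by rewrite c0 linear0 eq_sym mulf_eq0 (negPf (q_neq0 i)) orbF => /eqP.
Qed.

Lemma dual_basis_iso : exists2 f : A -> 'rV[k]_n, linear f & bijective f.
Proof.
exists (fun x => \row_i phi i x).
  by move=> c x y; apply/rowP => i; rewrite !mxE linearP.
exists (fun v : 'rV_n => \sum_i (v 0 i / q i) *: w i) => [x|v].
  have [c ->] := w_span x; apply: eq_bigr => i _.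
  by rewrite mxE phi_sum mulfK.
by apply/rowP => i; rewrite mxE phi_sum divfK.
Qed.

End DualBasis.

(** * Normal forms modulo the relations *)

(** Since [m < 8] is written uniquely as [4 i + j] with [i < 2] and [j < 4], an
    index in ['I_8] enumerates the monomials [u^i v^j] of the basis. *)
Definition monomial (A : nzRingType) (u v : A) (m : 'I_8) : A :=
  u ^+ (m %/ 4) * v ^+ (m %% 4).

Lemma lspanB_combine (k : nzRingType) (M : lmodType k) (P : M -> Prop) c
    (p q a b : M) : lspan P (p - a) -> lspan P (q - b) ->
  lspan P (c *: p + q - (c *: a + b)).
Proof.
move=> Ppa Pqb; rewrite opprD addrACA -scalerBr; apply: lspanD => //.
exact: lspanZ.
Qed.

(** As [xi^2 = -1], the relation [x y + xi y x] also says [y x = xi x y], which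
    moves every [x] to the left. *)
Lemma yx_relator (k : fieldType) (A : lalgType k) xi (x y p : A) :
  xi ^+ 2 = -1 ->
  y * (x * p) - xi *: (x * (y * p)) = - xi *: ((x * y + xi *: (y * x)) * p).
Proof.
move=> xi2; rewrite mulrDl scalerDr -scalerAl scalerA mulNr -expr2 xi2 opprK.
by rewrite scale1r scaleNr -!mulrA addrC.
Qed.

Section NormalForm.
Context (k : fieldType) (xi : k).
Local Notation F := (free_alg k 2).
Local Notation x := (fvar k ord0 : F).
Local Notation y := (fvar k ord_max : F).

Definition qplane_rels : seq F :=
  [:: x ^+ 2; x * y + xi *: (y * x); y ^+ 4].

Local Notation I := (ideal_gen qplane_rels).
Hypothesis xi2 : xi ^+ 2 = -1.

Local Notation free_monomial := (monomial x y).

Lemma free_eval_monomial (A : algType k) (u v : A) m :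
  free_eval (tnth [tuple u; v]) (free_monomial m) = monomial u v m.
Proof. by rewrite rmorphM !rmorphXn /= !free_eval_var. Qed.

Definition normalizable (p : F) : Prop :=
  exists c : 'I_8 -> k, I (p - \sum_m c m *: free_monomial m).

Lemma normalizableI p : I p -> normalizable p.
Proof.
move=> Ip; exists (fun=> 0); rewrite big1 ?subr0 // => m _; exact: scale0r.
Qed.

Lemma normalizableP c p q :
  normalizable p -> normalizable q -> normalizable (c *: p + q).
Proof.
move=> [a Ip] [b Iq]; exists (fun m => c * a m + b m).
have -> : \sum_m (c * a m + b m) *: free_monomial m =
    c *: (\sum_m a m *: free_monomial m) + \sum_m b m *: free_monomial m.
  rewrite scaler_sumr -big_split; apply: eq_bigr => m _.
  by rewrite scalerDl scalerA.
by have := lspanB_combine c Ip Iq; apply.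
Qed.

Lemma normalizable_monomial m : normalizable (free_monomial m).
Proof.
exists (fun n => (n == m)%:R); rewrite (bigD1 m) //= eqxx scale1r big1 ?addr0.
  by rewrite subrr; exact: lspan0.
by move=> n /negPf->; rewrite scale0r.
Qed.

Lemma normalizable_sum (c : 'I_8 -> k) (f : 'I_8 -> F) :
  (forall m, normalizable (f m)) -> normalizable (\sum_m c m *: f m).
Proof.
move=> nf; elim/big_rec: _ => [|m p _]; last exact: normalizableP.
by apply: normalizableI; exact: lspan0.
Qed.

Lemma normalizable_eqI p q : I (p - q) -> normalizable q -> normalizable p.
Proof.
move=> Ipq nq; rewrite -[p](subrK q) -[p - q]scale1r.
by apply: normalizableP nq; exact: normalizableI.
Qed.

Lemma qplane_x2 p : I (x * (x * p)).
Proof.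
rewrite mulrA; apply: ideal_mulr; apply: ideal_mem.
exact: (@mem_nth _ 0 qplane_rels 0 isT).
Qed.

Lemma qplane_yx p : I (y * (x * p) - xi *: (x * (y * p))).
Proof.
rewrite (@yx_relator _ F xi x y p xi2).
apply: lspanZ; apply: ideal_mulr; apply: ideal_mem.
exact: (@mem_nth _ 0 qplane_rels 1 isT).
Qed.

Lemma qplane_y4 : I (y * y ^+ 3).
Proof.
rewrite -(exprS y 3); apply: ideal_mem.
exact: (@mem_nth _ 0 qplane_rels 2 isT).
Qed.

Lemma monomialE (m : 'I_8) i j :
  (j < 4)%N -> m = (i * 4 + j)%N :> nat -> free_monomial m = x ^+ i * y ^+ j.
Proof.
move=> lt_j mE; have mi : (m %/ 4 = i)%N by rewrite mE divnMDl // divn_small // addn0.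
have mj : (m %% 4 = j)%N by rewrite mE modnMDl modn_small.
by rewrite /monomial mi mj.
Qed.

Lemma normalizable_xy i j : (i < 2)%N -> normalizable (x ^+ i * y ^+ j).
Proof.
move=> lt_i; have [lt_j | le_j] := ltnP j 4.
  have lt_m : (i * 4 + j < 8)%N.
    by case: i lt_i => [|[|i]] // _; case: j lt_j => [|[|[|[|j]]]].
  rewrite -(@monomialE (Ordinal lt_m)) //; exact: normalizable_monomial.
apply: normalizableI; apply: ideal_mull.
rewrite -(subnKC le_j) exprD; apply: ideal_mulr; exact: qplane_y4.
Qed.

Lemma normalizable_mulx m : normalizable (x * free_monomial m).
Proof.
have : (m %/ 4 < 2)%N by rewrite ltn_divLR.
rewrite /monomial; case: (m %/ 4)%N => [|[|i]] // _.
  by rewrite expr0 mul1r -{1}(expr1 x); exact: normalizable_xy.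
by apply: normalizableI; rewrite expr1; exact: qplane_x2.
Qed.

Lemma normalizable_muly m : normalizable (y * free_monomial m).
Proof.
have : (m %/ 4 < 2)%N by rewrite ltn_divLR.
rewrite /monomial; case: (m %/ 4)%N => [|[|i]] // _.
  rewrite expr0 mul1r -exprS -[y ^+ _]mul1r -(expr0 x); exact: normalizable_xy.
rewrite expr1; apply: normalizable_eqI (qplane_yx _) _; rewrite -exprS -{1}(expr1 x).
rewrite -[_ *: _]addr0; apply: normalizableP; first exact: normalizable_xy.
by apply: normalizableI; exact: lspan0.
Qed.

(** The normalizable polynomials form a subspace containing [1], and it is stable
    under left multiplication by the variables: modulo the ideal, a variable
    times a basis monomial is a multiple of a basis monomial. *)
Lemma normalizable_all p : normalizable p.
Proof.
elim/free_alg_ind: p => [|c p q||i p [c Ip]].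
- by apply: normalizableI; exact: lspan0.
- exact: normalizableP.
- have := @normalizable_xy 0 0 isT; by rewrite !expr0 mul1r.
apply: normalizable_eqI (_ : I (_ - fvar k i * \sum_m c m *: free_monomial m)) _.
  by rewrite -mulrBr; exact: ideal_mull.
rewrite mulr_sumr; under eq_bigr => m _ do rewrite free_alg_scalerAr.
apply: normalizable_sum => m.
case: (unliftP ord0 i) => [j ->|->]; last exact: normalizable_mulx.
by rewrite (_ : lift _ _ = ord_max) ?ord1 //; [exact: normalizable_muly|exact/val_inj].
Qed.

End NormalForm.

(** * Calculus of the two generators *)

Lemma iter_linear (k : nzRingType) (M : lmodType k) (f : {linear M -> M}) j :
  linear (iter j f).
Proof. by elim: j => [|j IHj] z u v //=; rewrite IHj linearP. Qed.

Lemma iterZ (k : nzRingType) (M : lmodType k) (f : {linear M -> M}) j z u :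
  iter j f (z *: u) = z *: iter j f u.
Proof. by elim: j => //= j ->; rewrite linearZ_LR. Qed.

(** The action of the generators [a, b, c, d] of the Hopf algebra on the Nichols
    algebra, seen as four operators: the Leibniz rules encode the coproducts,
    and the values at [1], [x], [y] determine the operators on the subalgebra
    generated by [x] and [y]. *)
Record twisted_action (k : fieldType) (xi : k) (R : algType k)
    (a b c d : {linear R -> R}) (x y : R) : Prop := {
  twist_aM : forall r s, a (r * s) = a r * a s + b r * c s;
  twist_bM : forall r s, b (r * s) = a r * b s + b r * d s;
  twist_cM : forall r s, c (r * s) = c r * a s + d r * c s;
  twist_dM : forall r s, d (r * s) = c r * b s + d r * d s;
  twist_1 : [/\ a 1 = 1, b 1 = 0, c 1 = 0 & d 1 = 1];
  twist_x : [/\ a x = - x, b x = 0, c x = 0 & d x = - x];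
  twist_y : [/\ a y = xi *: y, b y = x, c y = x & d y = - xi *: y]
}.

Section Plane.
Context (k : fieldType) (xi beta : k) (R : algType k).
Context (a b c d : {linear R -> R}) (x y : R).
Hypotheses (xi2 : xi ^+ 2 = -1) (twist : twisted_action xi a b c d x y).

Let aM := twist_aM twist.
Let bM := twist_bM twist.
Let cM := twist_cM twist.
Let dM := twist_dM twist.
Let act1 : [/\ a 1 = 1, b 1 = 0, c 1 = 0 & d 1 = 1] := twist_1 twist.
Let actx : [/\ a x = - x, b x = 0, c x = 0 & d x = - x] := twist_x twist.
Let acty : [/\ a y = xi *: y, b y = x, c y = x & d y = - xi *: y] := twist_y twist.

Hypotheses (x2 : x * x = 0) (yx : y * x = xi *: (x * y)).

Lemma xxM (p : R) : x * (x * p) = 0.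
Proof. by rewrite mulrA x2 mul0r. Qed.

Lemma yxM (p : R) : y * (x * p) = xi *: (x * (y * p)).
Proof. by rewrite mulrA yx -scalerAl mulrA. Qed.

(** The xi-integer [1 + xi + ... + xi^(n-1)]. *)
Definition qint n : k := \sum_(i < n) xi ^+ i.

Lemma qintS n : qint n.+1 = qint n + xi ^+ n.
Proof. exact: big_ord_recr. Qed.

Lemma qint0 : qint 0 = 0.
Proof. exact: big_ord0. Qed.

Lemma qint1 : qint 1 = 1.
Proof. by rewrite qintS qint0 add0r. Qed.

Lemma qint2 : qint 2 = 1 + xi.
Proof. by rewrite qintS qint1 expr1. Qed.

Lemma qint3 : qint 3 = xi.
Proof. by rewrite qintS qint2 xi2 addrC addKr. Qed.

(** The two formulas need each other: [a (y s)] contains [x * c s], killed by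
    [x * x = 0], and [c (y s)] contains [x * a s].  At [n = 0] the predecessor in
    the exponent is harmless since [qint 0 = 0]. *)
Lemma ac_yn n : a (y ^+ n) = xi ^+ n *: y ^+ n /\
  c (y ^+ n) = qint n *: (x * y ^+ n.-1).
Proof.
have [a1 _ c1 _] := act1; have [ay by_ cy dy] := acty.
elim: n => [|n [IHa IHc]].
  by rewrite a1 c1 qint0 scale1r !scale0r.
rewrite exprS aM cM IHa IHc ay by_ cy dy -!scalerAl -!scalerAr xxM.
rewrite scaler0 addr0 !scalerA; split; first by rewrite !exprS.
case: n {IHa IHc} => [|n].
  by rewrite qintS qint0 mulr0 !scale0r !addr0 add0r.
rewrite /= yxM -exprS !scalerA -scalerDl [qint n.+2]qintS; congr (_ *: _).
by ring: xi2.
Qed.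

Lemma bd_yn n : d (y ^+ n) = (- xi) ^+ n *: y ^+ n /\
  b (y ^+ n) = ((-1) ^+ n.-1 * qint n) *: (x * y ^+ n.-1).
Proof.
have [_ b1 _ d1] := act1; have [ay by_ cy dy] := acty.
elim: n => [|n [IHd IHb]].
  by rewrite b1 d1 qint0 scale1r mulr0 !scale0r.
rewrite exprS dM bM IHd IHb ay by_ cy dy -!scalerAl -!scalerAr xxM.
rewrite scaler0 add0r !scalerA; split; first by rewrite !exprS.
case: n {IHd IHb} => [|n].
  by rewrite qintS qint0 !mulr0 !scale0r !add0r !expr0 mul1r !scale1r.
rewrite /= yxM -exprS !scalerA -scalerDl [qint n.+2]qintS; congr (_ *: _).
rewrite [(- xi) ^+ _]exprNn !exprS.
by ring: xi2.
Qed.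

Lemma a_yn n : a (y ^+ n) = xi ^+ n *: y ^+ n.
Proof. by case: (ac_yn n). Qed.
Lemma b_yn n : b (y ^+ n) = ((-1) ^+ n.-1 * qint n) *: (x * y ^+ n.-1).
Proof. by case: (bd_yn n). Qed.
Lemma c_yn n : c (y ^+ n) = qint n *: (x * y ^+ n.-1).
Proof. by case: (ac_yn n). Qed.
Lemma d_yn n : d (y ^+ n) = (- xi) ^+ n *: y ^+ n.
Proof. by case: (bd_yn n). Qed.

Lemma a_xyn n : a (x * y ^+ n) = - xi ^+ n *: (x * y ^+ n).
Proof.
have [ax bx _ _] := actx.
by rewrite aM ax bx mul0r addr0 a_yn mulNr -scalerAr scaleNr.
Qed.

(** The coproduct enters only through the bilinearity of the tensor product,
    written [**], and through the effect of left multiplication by [x] and [y];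
    it is therefore replaced by a linear map [Delta] to a vector space [T] with
    a bilinear map [ot]. *)
Section Coproduct.
Context (T : lmodType k) (ot : R -> R -> T) (Delta : {linear R -> T})
  (xleft yleft : {linear T -> T}).
Local Notation "u ** v" := (ot u v) (at level 40).
Hypotheses (ot_l : forall v, linear (ot^~ v)) (ot_r : forall u, linear (ot u)).
Hypotheses (Delta_xM : forall s, Delta (x * s) = xleft (Delta s))
  (Delta_yM : forall s, Delta (y * s) = yleft (Delta s)).
Hypotheses
  (xleftE : forall u v, xleft (u ** v) =
     (x * u) ** v + (d u ** (x * v) + ((xi - 1) *: c u) ** (y * v)))
  (yleftE : forall u v, yleft (u ** v) =
     (y * u) ** v + (a u ** (y * v) + (beta *: b u) ** (x * v))).
Hypotheses (Delta_x : Delta x = x ** 1 + 1 ** x)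
  (Delta_y : Delta y = y ** 1 + 1 ** y).

Lemma otDl u u' v : (u + u') ** v = u ** v + u' ** v.
Proof. by have := ot_l v 1 u u'; rewrite !scale1r. Qed.

Lemma otDr u v v' : u ** (v + v') = u ** v + u ** v'.
Proof. by have := ot_r u 1 v v'; rewrite !scale1r. Qed.

Lemma ot0l v : 0 ** v = 0.
Proof. by apply: (addrI (0 ** v)); rewrite -otDl !addr0. Qed.

Lemma ot0r u : u ** 0 = 0.
Proof. by apply: (addrI (u ** 0)); rewrite -otDr !addr0. Qed.

Lemma otZl z u v : (z *: u) ** v = z *: (u ** v).
Proof. by have := ot_l v z u 0; rewrite ot0l !addr0. Qed.

Lemma otZr z u v : u ** (z *: v) = z *: (u ** v).
Proof. by have := ot_r u z v 0; rewrite ot0r !addr0. Qed.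

Lemma otNl u v : (- u) ** v = - (u ** v).
Proof. by rewrite -[- u]scaleN1r otZl scaleN1r. Qed.

Lemma x2_primitive : Delta (x * x) = (x * x) ** 1 + 1 ** (x * x).
Proof.
have [_ _ c1 d1] := act1; have [_ _ cx dx] := actx.
rewrite Delta_xM Delta_x linearD /= !xleftE c1 cx d1 dx.
by rewrite !scaler0 !ot0l !addr0 !mulr1 otNl -addrA addKr.
Qed.

Lemma xy_primitive :
  let r := x * y + xi *: (y * x) in Delta r = r ** 1 + 1 ** r.
Proof.
have [a1 b1 c1 d1] := act1; have [ax bx _ _] := actx; have [_ _ cy dy] := acty.
rewrite /= linearD linearZ_LR /= Delta_xM Delta_yM Delta_x Delta_y !linearD /=.
rewrite !xleftE !yleftE a1 b1 c1 d1 ax bx cy dy !scaler0 !ot0l !addr0 !mulr1.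
rewrite !otDl !otDr !otZl !otZr otNl !scalerDr scalerBl.
rewrite !scaleNr !scale1r !scalerN !addrA.
(* The terms in [y ** x] and [x ** y] cancel in pairs. *)
rewrite [LHS](ACl (1*7*(6*10)*(9*2)*(3*8)*(5*4))) /= !subrr !addr0.
by rewrite addrA.
Qed.

(** Expanding a coproduct along the monomials [1, y, y^2, y^3, x, x y] in the
    right factor, left multiplication by [y] acts on the vector of coefficients:
    [a] shifts the exponent of [y], and [b] feeds the coefficient of [x y^j] from
    that of [y^j].  The last two hypotheses say that no term in [x y^2] or
    [x y^3] appears, which is the case up to [y^4]. *)
Lemma Delta_y_step (s u0 u1 u2 u3 v0 v1 u0' u1' u2' u3' u4' v0' v1' : R) :
  Delta s = u0 ** 1 + u1 ** y + u2 ** y ^+ 2 + u3 ** y ^+ 3 +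
    v0 ** x + v1 ** (x * y) ->
  y * u0 = u0' -> y * u1 + a u0 = u1' -> y * u2 + a u1 = u2' ->
  y * u3 + a u2 = u3' -> a u3 = u4' ->
  y * v0 + beta *: b u0 = v0' -> y * v1 + xi *: a v0 + beta *: b u1 = v1' ->
  xi *: a v1 + beta *: b u2 = 0 -> b u3 = 0 ->
  Delta (y * s) = u0' ** 1 + u1' ** y + u2' ** y ^+ 2 + u3' ** y ^+ 3 +
    v0' ** x + v1' ** (x * y) + u4' ** y ^+ 4.
Proof.
move=> sE <- <- <- <- <- <- <- v2E u3E; rewrite Delta_yM sE !linearD /= !yleftE u3E.
rewrite !mulr1 !xxM !yxM yx x2 -!expr2 -!exprS scaler0 !ot0r ot0l !otDl !otZl !otZr.
rewrite !addr0 !addrA.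
(* The two terms in [x * y ^+ 2] are the ones that cancel by [v2E]. *)
have v2E' : xi *: (a v1 ** (x * y ^+ 2)) + beta *: (b u2 ** (x * y ^+ 2)) = 0.
  by rewrite -!otZl -otDl v2E ot0l.
by rewrite [LHS](ACl (1*4*2*7*5*10*8*12*3*14*13*6*11*(15*9))) /= v2E' addr0.
Qed.

(** Three left multiplications by [y], starting from [Delta y].  In the last one
    the coefficients of [y], [y^2], [y^3] are xi-binomials of [4], which vanish
    because [xi] has order 4; those of [x] and [x y] cancel as well. *)
Lemma y4_primitive : Delta (y ^+ 4) = y ^+ 4 ** 1 + 1 ** y ^+ 4.
Proof.
have aZ z r : a (z *: r) = z *: a r by exact: linearZ_LR.
have bZ z r : b (z *: r) = z *: b r by exact: linearZ_LR.
have [a1 b1 _ _] := act1; have [ax bx _ _] := actx; have [ay by_ _ _] := acty.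
have E2 : Delta (y ^+ 2) = y ^+ 2 ** 1 + ((1 + xi) *: y) ** y + 1 ** y ^+ 2 +
    0 ** y ^+ 3 + (beta *: x) ** x + 0 ** (x * y).
  (* Up to [y^3] the coefficient of [y^4] is zero. *)
  rewrite {1}expr2 -[RHS]addr0 -[X in _ + X](ot0l (y ^+ 4)).
  apply: (@Delta_y_step y y 1 0 0 0 0).
  - by rewrite Delta_y !ot0l !addr0.
  - by rewrite expr2.
  - by rewrite mulr1 ay scalerDl scale1r.
  - by rewrite mulr0 add0r a1.
  - by rewrite mulr0 add0r linear0.
  - by rewrite linear0.
  - by rewrite mulr0 add0r by_.
  - by rewrite mulr0 add0r !linear0 b1 linear0 addr0.
  - by rewrite !linear0 addr0.
  - by rewrite linear0.
have E3 : Delta (y ^+ 3) = y ^+ 3 ** 1 + (xi *: y ^+ 2) ** y +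
    (xi *: y) ** y ^+ 2 + 1 ** y ^+ 3 + (- beta *: (x * y)) ** x +
    (beta *: x) ** (x * y).
  rewrite {1}(exprS y 2) -[RHS]addr0 -[X in _ + X](ot0l (y ^+ 4)).
  apply: Delta_y_step E2 _ _ _ _ _ _ _ _ _.
  - by rewrite exprS.
  - rewrite a_yn -scalerAr -expr2 -scalerDl xi2; congr (_ *: _); ring.
  - rewrite aZ ay mulr1 scalerA -{1}(scale1r y) -scalerDl.
    by congr (_ *: _); ring: xi2.
  - by rewrite mulr0 add0r a1.
  - by rewrite linear0.
  - rewrite b_yn qint2 -scalerAr yx expr1 !scalerA -scalerDl.
    by congr (_ *: _); ring.
  - rewrite mulr0 add0r aZ bZ ax by_ !scalerN !scalerA -scaleNr -scalerDl.
    by congr (_ *: _); ring.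
  - by rewrite linear0 b1 !scaler0 addr0.
  - by rewrite linear0.
have E4 : Delta (y * y ^+ 3) = y ^+ 4 ** 1 + 0 ** y + 0 ** y ^+ 2 + 0 ** y ^+ 3 +
    0 ** x + 0 ** (x * y) + 1 ** y ^+ 4.
  apply: Delta_y_step E3 _ _ _ _ _ _ _ _ _.
  - by rewrite -exprS.
  - rewrite a_yn -scalerAr -exprS -scalerDl -[RHS](scale0r (y ^+ 3)).
    by congr (_ *: _); ring: xi2.
  - rewrite aZ a_yn -scalerAr -expr2 scalerA -scalerDl.
    by rewrite -[RHS](scale0r (y ^+ 2)); congr (_ *: _); ring: xi2.
  - rewrite aZ ay mulr1 scalerA -{1}(scale1r y) -scalerDl.
    by rewrite -[RHS](scale0r y); congr (_ *: _); ring: xi2.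
  - by rewrite a1.
  - rewrite b_yn qint3 -scalerAr yxM -expr2 !scalerA -scalerDl.
    by rewrite -[RHS](scale0r (x * y ^+ 2)); congr (_ *: _); ring: xi2.
  - rewrite -scalerAr yx aZ bZ -{2}(expr1 y) a_xyn b_yn qint2 expr1.
    rewrite !scalerA -!scalerDl.
    by rewrite -[RHS](scale0r (x * y)); congr (_ *: _); ring: xi2.
  - rewrite aZ bZ ax by_ !scalerN !scalerA [xi * _]mulrC; exact: addNr.
  - exact: b1.
by rewrite {1}(exprS y 3) E4 !ot0l !addr0.
Qed.

End Coproduct.

(** [D1] and [D2] stand for the skew derivations attached to the coordinates
    along [x] and [y]; their Leibniz rules are read off the coactions of [x] and
    [y]. *)
Section Derivations.
Context (D1 D2 : {linear R -> R}) (eps : {scalar R}).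
Hypotheses (D1_1 : D1 1 = 0) (D2_1 : D2 1 = 0) (eps1 : eps 1 = 1).
Hypotheses (D1_xM : forall s, D1 (x * s) = x * D1 s + d s)
  (D1_yM : forall s, D1 (y * s) = y * D1 s + beta *: b s)
  (D2_xM : forall s, D2 (x * s) = x * D2 s + (xi - 1) *: c s)
  (D2_yM : forall s, D2 (y * s) = y * D2 s + a s).
Hypotheses (eps_xM : forall s, eps (x * s) = 0) (eps_yM : forall s, eps (y * s) = 0).

(** Only the shape of [D1 (y^n)] matters: starting with the factor [x], it is
    killed both by left multiplication by [x] and by [eps o D2^j]. *)
Lemma D1_yn n : exists z m, D1 (y ^+ n) = z *: (x * y ^+ m).
Proof.
have [_ b1 _ _] := act1; have [_ by_ _ _] := acty.
have D1y : D1 y = 0 by rewrite -[y]mulr1 D1_yM D1_1 b1 mulr0 scaler0 addr0.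
case: n => [|[|n]]; [by exists 0, 0; rewrite D1_1 scale0r| |].
  by exists 0, 0; rewrite D1y scale0r.
suff [z zE] : exists z, D1 (y ^+ n.+2) = z *: (x * y ^+ n) by exists z, n.
elim: n => [|n [z IHn]].
  by exists beta; rewrite expr2 D1_yM D1y by_ mulr0 add0r mulr1.
exists (z * xi + beta * ((-1) ^+ n.+1 * qint n.+2)).
by rewrite exprS D1_yM IHn b_yn -scalerAr yxM -exprS !scalerA -scalerDl.
Qed.

Lemma D1_xyn n : D1 (x * y ^+ n) = (- xi) ^+ n *: y ^+ n.
Proof.
by have [z [m zE]] := D1_yn n; rewrite D1_xM zE -scalerAr xxM scaler0 add0r d_yn.
Qed.

Lemma D2_yn n : D2 (y ^+ n) = qint n *: y ^+ n.-1.
Proof.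
elim: n => [|n IHn]; first by rewrite D2_1 qint0 scale0r.
rewrite exprS D2_yM IHn a_yn -scalerAr; case: n {IHn} => [|n].
  by rewrite qintS qint0 !scale0r !add0r.
by rewrite -exprS -scalerDl [qint n.+2]qintS.
Qed.

Lemma D2_xyn n : D2 (x * y ^+ n) = (xi * qint n) *: (x * y ^+ n.-1).
Proof.
rewrite D2_xM D2_yn c_yn -scalerAr !scalerA -scalerDl; congr (_ *: _); ring.
Qed.

Definition qfact n : k := \prod_(i < n) qint i.+1.

Lemma iter_D2_yn j n : eps (iter j D2 (y ^+ n)) = qfact j *+ (j == n).
Proof.
elim: j n => [|j IHj] n.
  rewrite /qfact big_ord0; case: n => [|n]; first exact: eps1.
  by rewrite /= exprS eps_yM.
have -> : qfact j.+1 = qfact j * qint j.+1 by exact: big_ord_recr.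
rewrite iterSr D2_yn iterZ linearZ_LR /= IHj.
case: n => [|n]; first by rewrite qint0 mul0r.
rewrite eqSS /=; case: eqP => [->|_]; last by rewrite mulr0.
exact: mulrC.
Qed.

Lemma iter_D2_xyn j n : eps (iter j D2 (x * y ^+ n)) = 0.
Proof.
elim: j n => [|j IHj] n; first exact: eps_xM.
by rewrite iterSr D2_xyn iterZ linearZ_LR /= IHj mulr0.
Qed.

Definition dual_monomial (m : 'I_8) (r : R) : k :=
  eps (iter (m %% 4) D2 (iter (m %/ 4) D1 r)).

Lemma dual_monomial_is_scalar m : scalar (dual_monomial m).
Proof. by move=> z r s; rewrite /dual_monomial !iter_linear linearP. Qed.

HB.instance Definition _ m := GRing.isLinear.Build k R k *%R (dual_monomial m)
  (dual_monomial_is_scalar m).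

(** [D2] lowers the exponent of [y] and keeps the factor [x]; [D1] removes the
    factor [x] from [x y^n] and turns [y^n] into a multiple of some [x y^m]; the
    counit kills all monomials except [1].  Hence only the matching monomial
    gives a nonzero value. *)
Lemma dual_monomialE (m n : 'I_8) :
  dual_monomial m (monomial x y n) =
    ((- xi) ^+ (m %/ 4 * (m %% 4)) * qfact (m %% 4)) *+ (m == n).
Proof.
have lt2 (p : 'I_8) : (p %/ 4 < 2)%N by rewrite ltn_divLR.
have -> : (m == n) = (m %/ 4 == n %/ 4)%N && (m %% 4 == n %% 4)%N.
  apply/eqP/andP => [->|[/eqP ed /eqP em]]; first by rewrite !eqxx.
  by apply/val_inj; rewrite /= (divn_eq m 4) (divn_eq n 4) ed em.
rewrite /dual_monomial /monomial; move: (m %% 4)%N (n %% 4)%N (lt2 m) (lt2 n) => i j.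
case: (m %/ 4)%N => [|[|//]] _; case: (n %/ 4)%N => [|[|//]] _ /=.
- by rewrite expr0 !mul1r iter_D2_yn.
- by rewrite expr1 iter_D2_xyn.
- have [z [l zE]] := D1_yn j.
  by rewrite expr0 mul1r zE iterZ linearZ_LR /= iter_D2_xyn mulr0.
- rewrite expr1 D1_xyn iterZ linearZ_LR /= iter_D2_yn mul1n.
  by case: eqP => [->|_]; rewrite ?mulr0.
Qed.

(** [(1 + xi)(1 - xi) = 2] shows that [1 + xi] is invertible. *)
Lemma dual_coef_neq0 (m : 'I_8) : 2%:R != 0 :> k ->
  (- xi) ^+ (m %/ 4 * (m %% 4)) * qfact (m %% 4) != 0.
Proof.
move=> two0; have xi0 : xi != 0.
  by apply: contra_eq_neq xi2 => ->; rewrite expr0n eq_sym oppr_eq0 oner_eq0.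
rewrite mulf_neq0 ?expf_neq0 ?oppr_eq0 //.
have lt4 : (m %% 4 < 4)%N by rewrite ltn_mod.
have q20 : 1 + xi != 0.
  apply: contra_neq two0 => q0; transitivity ((1 + xi) * (1 - xi));
    last by rewrite q0 mul0r.
  by ring: xi2.
rewrite /qfact; apply/prodf_neq0 => -[i lt_i] _ /=.
have : (i < 3)%N by apply: leq_trans lt_i _; rewrite -ltnS.
by case: i {lt_i} => [|[|[|//]]] _; rewrite ?qint1 ?qint2 ?qint3 ?oner_eq0.
Qed.

End Derivations.
End Plane.

(** * The Nichols algebra of the module *)

Section NicholsV21.
Context (k : fieldType) (xi : k) (K : hopfAlgType k) (a b c d : K).
Context (V : ydModType K) (e1 e2 : V).
Context (B : braidedHopfType K) (G : nat -> B -> Prop) (iota : {linear V -> B}).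
Hypotheses (two_neq0 : 2%:R != 0 :> k) (xi2 : xi ^+ 2 = -1).
Hypotheses (K_def : is_K xi a b c d) (V_def : is_V1 xi a b c d 2%:R e1 e2).
Hypothesis B_def : is_Nichols G iota.

Local Notation x := (iota e1).
Local Notation y := (iota e2).
(** The coefficient of [b # e1] in the coaction of [e2], as [lambda = -1]. *)
Let beta : k := - (2%:R^-1 * (1 + xi)).

Lemma xi_pow2 : xi ^+ (2%:R : 'Z_4) = -1.
Proof. exact: xi2. Qed.

Lemma twisted_action_B :
  twisted_action xi (act a : {linear B -> B}) (act b) (act c) (act d) x y.
Proof.
have [ca cb cc cd] := K_comul K_def; have [ea eb ec ed] := K_counit K_def.
have [ae1 be1 ce1 de1] := V1_act1 V_def; have [ae2 be2 ce2 de2] := V1_act2 V_def.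
split=> [r s|r s|r s|r s| | |] /=; try exact: act_mul2.
- by rewrite !actr1 ea eb ec ed scale1r scale0r.
- rewrite -!(Nichols_iota_act B_def) ae1 be1 ce1 de1 !linear0 xi_pow2.
  by rewrite invrN1 !scaleN1r !linearN.
- rewrite -!(Nichols_iota_act B_def) ae2 be2 ce2 de2 xi_pow2.
  by rewrite invrN1 mulrN1 opprK sqrrN expr1n scale1r !linearZ.
Qed.

Lemma coact_iota v (h1 h2 : K) v1 v2 :
  coact v = h1 \ox v1 + h2 \ox v2 ->
  coact (iota v) = h1 \ox iota v1 + h2 \ox iota v2.
Proof.
move=> vE; rewrite (Nichols_iota_coact B_def) vE.
have fl w : linear (fun h : K => h \ox iota w).
  by move=> z h h'; rewrite tensDl tensZl.
have fr (h : K) : linear (fun w : V => h \ox iota w).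
  by move=> z w w'; rewrite linearP tensDr tensZr.
by rewrite (tsum_tens2 _ _ _ _ fl fr).
Qed.

Lemma coact_x : coact x = d \ox x + ((xi - 1) *: c) \ox y.
Proof.
apply: coact_iota; have [-> _] := V1_coact V_def; rewrite xi_pow2.
by have -> : (-1) ^+ 3 - xi * -1 = xi - 1 :> k by ring.
Qed.

Lemma coact_y : coact y = a \ox y + (beta *: b) \ox x.
Proof.
apply: coact_iota; have [_ ->] := V1_coact V_def; rewrite xi_pow2 /beta.
have -> : -1 + xi * (-1) ^+ 3 = - (1 + xi) :> k by ring.
by rewrite mulrN.
Qed.

Let tensl (v : B) : linear (fun u : B => u \ox v).
Proof. by move=> z u u'; rewrite tensDl tensZl. Qed.

Let tensr (u : B) : linear (fun v : B => u \ox v).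
Proof. by move=> z v v'; rewrite tensDr tensZr. Qed.

Let bcomul_xM (s : B) : bcomul (x * s) = primitive_left x (bcomul s).
Proof. exact: bcomul_primitiveM (iota_primitive B_def e1). Qed.

Let bcomul_yM (s : B) : bcomul (y * s) = primitive_left y (bcomul s).
Proof. exact: bcomul_primitiveM (iota_primitive B_def e2). Qed.

Let xleftE (u v : B) : primitive_left x (u \ox v) = (x * u) \ox v +
  ((d \act u) \ox (x * v) + ((xi - 1) *: (c \act u)) \ox (y * v)).
Proof. by rewrite (primitive_left_tens u v coact_x) actZl. Qed.

Let yleftE (u v : B) : primitive_left y (u \ox v) = (y * u) \ox v +
  ((a \act u) \ox (y * v) + (beta *: (b \act u)) \ox (x * v)).
Proof. by rewrite (primitive_left_tens u v coact_y) actZl. Qed.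

Let Gx : G 1 x := iota_deg1 B_def e1.
Let Gy : G 1 y := iota_deg1 B_def e2.
Let GM := grading_mul (Nichols_grading B_def).

Lemma x2_eq0 : x * x = 0.
Proof.
apply: (primitive_eq0 B_def (GM Gx Gx)) => //.
exact: (x2_primitive twisted_action_B tensl bcomul_xM xleftE (iota_primitive B_def e1)).
Qed.

Lemma yx_commute : y * x = xi *: (x * y).
Proof.
have : x * y + xi *: (y * x) = 0.
  apply: (primitive_eq0 B_def (n := 2)) => //.
    have Ggr := hopf_grading (Nichols_grading B_def).
    by apply: (gradingD Ggr (GM Gx Gy)); apply: gradingZ (GM Gy Gx).
  exact: (xy_primitive twisted_action_B tensl tensr bcomul_xM bcomul_yM xleftE yleftE
    (iota_primitive B_def e1) (iota_primitive B_def e2)).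
move/(congr1 (fun z => - xi *: z)); rewrite scaler0 scalerDr scalerA mulNr -expr2.
by rewrite xi2 opprK scale1r scaleNr => /eqP; rewrite addrC subr_eq0 => /eqP.
Qed.

Lemma y4_eq0 : y ^+ 4 = 0.
Proof.
apply: (primitive_eq0 B_def (n := 4)) => //.
  by rewrite !exprS expr0 mulr1; apply: GM Gy (GM Gy (GM Gy Gy)).
exact: (y4_primitive xi2 twisted_action_B x2_eq0 yx_commute tensl tensr bcomul_yM
  yleftE (iota_primitive B_def e2)).
Qed.

Definition V1_coord (v : V) : k * k := projT1 (cid (V1_basis V_def v)).

Lemma V1_coordE z1 z2 : V1_coord (z1 *: e1 + z2 *: e2) = (z1, z2).
Proof. by rewrite /V1_coord; case: cid => s [_ uniq_s] /=; exact: uniq_s. Qed.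

Lemma V1_coordK v : v = (V1_coord v).1 *: e1 + (V1_coord v).2 *: e2.
Proof. by have [] := projT2 (cid (V1_basis V_def v)). Qed.

Lemma V1_coordP z u v :
  V1_coord (z *: u + v) = (z * (V1_coord u).1 + (V1_coord v).1,
                           z * (V1_coord u).2 + (V1_coord v).2).
Proof.
rewrite -V1_coordE; congr V1_coord.
have := V1_coordK u; have := V1_coordK v.
move: (V1_coord u) (V1_coord v) => p q -> ->.
by rewrite scalerDr !scalerA !scalerDl addrACA.
Qed.

Definition V1_coord1 (v : V) : k := (V1_coord v).1.
Definition V1_coord2 (v : V) : k := (V1_coord v).2.

Lemma V1_coord1_is_scalar : scalar V1_coord1.
Proof. by move=> z r s; rewrite /V1_coord1 V1_coordP. Qed.
Lemma V1_coord2_is_scalar : scalar V1_coord2.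
Proof. by move=> z r s; rewrite /V1_coord2 V1_coordP. Qed.

HB.instance Definition _ :=
  GRing.isLinear.Build k V k *%R V1_coord1 V1_coord1_is_scalar.
HB.instance Definition _ :=
  GRing.isLinear.Build k V k *%R V1_coord2 V1_coord2_is_scalar.

Let V1_coord_e1 : V1_coord e1 = (1, 0).
Proof. by rewrite -V1_coordE scale1r scale0r addr0. Qed.
Let V1_coord_e2 : V1_coord e2 = (0, 1).
Proof. by rewrite -V1_coordE scale1r scale0r add0r. Qed.

Let f1 : {scalar B} := degree1_form B_def V1_coord1.
Let f2 : {scalar B} := degree1_form B_def V1_coord2.
Let D1 : {linear B -> B} := contraction f1.
Let D2 : {linear B -> B} := contraction f2.

Let f1x : f1 x = 1.
Proof.
apply: etrans (degree1_form_iota B_def V1_coord1 e1) _.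
by rewrite /= /V1_coord1 V1_coord_e1.
Qed.
Let f1y : f1 y = 0.
Proof.
apply: etrans (degree1_form_iota B_def V1_coord1 e2) _.
by rewrite /= /V1_coord1 V1_coord_e2.
Qed.
Let f2x : f2 x = 0.
Proof.
apply: etrans (degree1_form_iota B_def V1_coord2 e1) _.
by rewrite /= /V1_coord2 V1_coord_e1.
Qed.
Let f2y : f2 y = 1.
Proof.
apply: etrans (degree1_form_iota B_def V1_coord2 e2) _.
by rewrite /= /V1_coord2 V1_coord_e2.
Qed.

Lemma D1_xM s : D1 (x * s) = x * D1 s + (d \act s).
Proof.
rewrite /D1 /= (contraction_primitiveM2 _ (iota_primitive B_def e1) _ coact_x).
  by rewrite f1x f1y scale1r scale0r addr0.
exact: degree1_formM.
Qed.

Lemma D1_yM s : D1 (y * s) = y * D1 s + beta *: (b \act s).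
Proof.
rewrite /D1 /= (contraction_primitiveM2 _ (iota_primitive B_def e2) _ coact_y).
  by rewrite f1x f1y scale1r scale0r add0r actZl.
exact: degree1_formM.
Qed.

Lemma D2_xM s : D2 (x * s) = x * D2 s + (xi - 1) *: (c \act s).
Proof.
rewrite /D2 /= (contraction_primitiveM2 _ (iota_primitive B_def e1) _ coact_x).
  by rewrite f2x f2y scale1r scale0r add0r actZl.
exact: degree1_formM.
Qed.

Lemma D2_yM s : D2 (y * s) = y * D2 s + (a \act s).
Proof.
rewrite /D2 /= (contraction_primitiveM2 _ (iota_primitive B_def e2) _ coact_y).
  by rewrite f2x f2y scale1r scale0r addr0.
exact: degree1_formM.
Qed.

Lemma bcounit_iotaM (v : V) s : bcounit (iota v * s) = 0.
Proof. by rewrite bcounitM bcounit_primitive ?mul0r //; exact: (iota_primitive B_def). Qed.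

Lemma dual_monomial_B (m n : 'I_8) :
  dual_monomial D1 D2 bcounit m (monomial x y n) =
  (- xi) ^+ (m %/ 4 * (m %% 4)) * qfact xi (m %% 4) *+ (m == n).
Proof.
apply: (dual_monomialE xi2 twisted_action_B x2_eq0 yx_commute _ _ bcounit1
  D1_xM D1_yM D2_xM D2_yM (bcounit_iotaM e1) (bcounit_iotaM e2)).
  by apply: contraction1; exact: degree1_form1.
by apply: contraction1; exact: degree1_form1.
Qed.

Local Notation eval := (free_eval (tnth [tuple x; y])).

Lemma qplane_ideal_eval0 p : ideal_gen (qplane_rels xi) p -> eval p = 0.
Proof.
apply: free_eval_ideal => r; rewrite !inE => /or3P[] /eqP ->.
- by rewrite rmorphXn /= free_eval_var expr2; exact: x2_eq0.
- apply: etrans (free_evalD _ _ _) _.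
  have -> := free_evalMvar (tnth [tuple x; y]) ord0 ord_max.
  have -> := free_evalZ (tnth [tuple x; y]) xi (fvar k ord_max * fvar k ord0).
  have -> /= := free_evalMvar (tnth [tuple x; y]) ord_max ord0.
  by rewrite yx_commute scalerA -expr2 xi2 scaleN1r subrr.
- by rewrite rmorphXn /= free_eval_var; exact: y4_eq0.
Qed.

Lemma eval_surjective r : exists p, eval p = r.
Proof.
elim/(Nichols_ind B_def): r => [z _ _ [p <-] [q <-]||v _ [p <-]].
- by exists (z *: p + q); rewrite linearP.
- by exists 1; rewrite free_eval1.
exists (((V1_coord v).1 *: fvar k ord0 + (V1_coord v).2 *: fvar k ord_max) * p).
apply: etrans (free_evalM _ _ _) _; congr (_ * _); apply: etrans (free_evalD _ _ _) _.
have e i w : eval (w *: fvar k i) = w *: tnth [tuple x; y] i.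
  by rewrite free_evalZ free_eval_var.
have -> : iota v = (V1_coord v).1 *: x + (V1_coord v).2 *: y.
  by rewrite {1}(V1_coordK v) linearD !linearZ_LR.
exact: congr2 (e _ _) (e _ _).
Qed.

Local Notation free_monomial := (monomial (fvar k ord0) (fvar k ord_max)).

Lemma eval_normal p : exists z : 'I_8 -> k,
  ideal_gen (qplane_rels xi) (p - \sum_m z m *: free_monomial m) /\
  eval p = \sum_m z m *: monomial x y m.
Proof.
have [z Iz] := normalizable_all xi2 p; exists z; split => //.
have -> : \sum_m z m *: monomial x y m =
    eval (\sum_m z m *: free_monomial m).
  rewrite linear_sum; apply: eq_bigr => m _ /=.
  by rewrite free_evalZ free_eval_monomial.
apply/eqP; rewrite -subr_eq0; apply/eqP; rewrite -[RHS](qplane_ideal_eval0 Iz).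
exact/esym/(linearB (free_eval (tnth [tuple x; y]))).
Qed.

Lemma monomial_span r : exists z : 'I_8 -> k, r = \sum_m z m *: monomial x y m.
Proof.
have [p <-] := eval_surjective r; have [z [_ zE]] := eval_normal p.
by exists z.
Qed.

Lemma qplane_presented : presented_by (tnth [tuple x; y]) (qplane_rels xi).
Proof.
split=> [r|p]; first exact: eval_surjective.
split=> [p0|]; last exact: qplane_ideal_eval0.
have [z [Iz zE]] := eval_normal p; rewrite p0 in zE.
have z0 := dual_basis_free (fun m => dual_coef_neq0 xi2 m two_neq0)
  dual_monomial_B (esym zE).
move: Iz; rewrite big1 ?subr0 // => m _; rewrite z0; exact: scale0r.
Qed.

Lemma qplane_iso : exists2 f : B -> 'rV[k]_8, linear f & bijective f.
Proof.
exact: dual_basis_iso (fun m => dual_coef_neq0 xi2 m two_neq0)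
  dual_monomial_B monomial_span.
Qed.

End NicholsV21.

Theorem proposition4p8 (k : closedFieldType) (char0 : [pchar k] =i pred0)
    (xi : k) (xi_prim : 4.-primitive_root xi)
    (K : hopfAlgType k) (a b c d : K) (K_def : is_K xi a b c d)
    (V : ydModType K) (e1 e2 : V) (V_def : is_V1 xi a b c d 2%:R e1 e2)
    (B : braidedHopfType K) (B_ : nat -> B -> Prop) (iota : {linear V -> B})
    (B_def : is_Nichols B_ iota) :
  presented_by (tnth [tuple iota e1; iota e2])
    (let x : free_alg k 2 := fvar k ord0 in
     let y : free_alg k 2 := fvar k ord_max in
     [:: x ^+ 2; x * y + xi *: (y * x); y ^+ 4]) /\
  (exists2 f : B -> 'rV[k]_8, linear f & bijective f).
Proof.
have two_neq0 : 2%:R != 0 :> k by rewrite (proj1 (pcharf0P _) char0).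
have xi2 : xi ^+ 2 = -1.
  have := prim_expr_order xi_prim; rewrite (exprM xi 2 2) => /eqP.
  by rewrite sqrf_eq1 -(prim_order_dvd xi_prim) => /eqP.
split; first exact: qplane_presented two_neq0 xi2 K_def V_def B_def.
exact: qplane_iso two_neq0 xi2 K_def V_def B_def.
Qed.
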